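(* (Langlands formula) Let $\mathfrak p_1,\mathfrak p_2\in\mathcal P_{G,T}$ be parabolic subalgebras of $\mathfrak g$ containing $\mathfrak h$, and let $W_i=\mathrm{Stab}_W(\mathfrak p_i)\subset W$, $i=1,2$. Then in the perverse Coxeter category $\mathcal C=\mathcal Q^W$ the following equality of morphisms $W\mathfrak p_1\to W\mathfrak p_2$ holds: $$\underline{\mathrm{Res}}_{\mathfrak g}^{\mathfrak p_2}\circ\underline{\mathrm{Ind}}_{\mathfrak p_1}^{\mathfrak g}=\sum_{w\in W_1\backslash W/W_2}\underline{\mathrm{Ind}}_{(w\mathfrak p_2)\circ\mathfrak p_1}^{w\mathfrak p_2}\circ\underline{\tau}_{\mathfrak p_1\circ(w\mathfrak p_2)}^{(w\mathfrak p_2)\circ\mathfrak p_1}\circ\underline{\mathrm{Res}}_{\mathfrak p_1}^{\mathfrak p_1\circ(w\mathfrak p_2)} .$$ Here $\mathfrak p\circ\mathfrak q$ between parabolic subalgebras denotes the Tits product, the sum is over representatives $w$ of the double cosets, and underlining denotes averaging.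
   Context: **Roots and cells.** $\mathbf k$ is a field of characteristic $0$; $G$ is a complex reductive algebraic group, $T$ a maximal torus, $\mathfrak g=\mathrm{Lie}(G)$, $\mathfrak h=\mathrm{Lie}(T)$, $\Delta\subset\mathfrak h^*$ the root system, $W$ its Weyl group, $\mathfrak h_{\mathbb R}\subset\mathfrak h$ the real form containing the coroots, on which roots are real. $\mathcal P_{G,T}$ is the set of parabolic subalgebras of $\mathfrak g$ containing $\mathfrak h$; $W$ acts on it. For $\mathfrak p\in\mathcal P_{G,T}$: $\Delta_{\mathfrak p}\subset\Delta$ is the set of roots occurring in $\mathfrak p$, $\mathfrak n_{\mathfrak p}$ its nilpotent radical, $\pi(\mathfrak p)$ its Levi subalgebra containing $\mathfrak h$; $C_{\mathfrak p}=\{x\in\mathfrak h_{\mathbb R}:\alpha(x)\ge0\ \forall\alpha\in\Delta_{\mathfrak p}\}$ with relative interior $C^\circ_{\mathfrak p}$. The $C^\circ_{\mathfrak p}$ are the faces of the root arrangement; $\mathfrak p\subset\mathfrak p'$ iff $C_{\mathfrak p'}\subset C_{\mathfrak p}$. $(\mathfrak p,\mathfrak p',\mathfrak p'')$ is collinear if there are points $a,b,c$ of $C^\circ_{\mathfrak p},C^\circ_{\mathfrak p'},C^\circ_{\mathfrak p''}$ with $b\in[a,c]$. **Tits product.** For $\mathfrak p,\mathfrak q\in\mathcal P_{G,T}$ let $\mathfrak l=\pi(\mathfrak p)\cap\pi(\mathfrak q)$ and let $H_{\mathfrak l}\subset\mathfrak h_{\mathbb R}$ be the common zero space of the roots of $\mathfrak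 l$. $\mathfrak p\circ\mathfrak q\in\mathcal P_{G,T}$ is the parabolic whose cell is the first chamber (face open in $H_{\mathfrak l}$) met by any segment going from a point of $C^\circ_{\mathfrak p}$ to a point of $C^\circ_{\mathfrak q}$; equivalently $\mathfrak p\circ\mathfrak q=(\mathfrak p\cap\mathfrak q)+\mathfrak n_{\mathfrak p}$. **The double incidence category $\mathcal Q$.** The $\mathbf k$-linear category with object set $\mathcal P_{G,T}$, generated by $\mathrm{Ind}_{\mathfrak p}^{\mathfrak p'}:\mathfrak p\to\mathfrak p'$ and $\mathrm{Res}_{\mathfrak p'}^{\mathfrak p}:\mathfrak p'\to\mathfrak p$ for $\mathfrak p\subset\mathfrak p'$, with relations: (2a) $\mathrm{Ind}_{\mathfrak p}^{\mathfrak p}=\mathrm{Res}_{\mathfrak p}^{\mathfrak p}=\mathrm{Id}$; (2b) for $\mathfrak p\subset\mathfrak p'\subset\mathfrak p''$, $\mathrm{Ind}_{\mathfrak p'}^{\mathfrak p''}\mathrm{Ind}_{\mathfrak p}^{\mathfrak p'}=\mathrm{Ind}_{\mathfrak p}^{\mathfrak p''}$, $\mathrm{Res}_{\mathfrak p'}^{\mathfrak p}\mathrm{Res}_{\mathfrak p''}^{\mathfrak p'}=\mathrm{Res}_{\mathfrak p''}^{\mathfrak p}$; (2c) $\mathrm{Res}_{\mathfrak p'}^{\mathfrak p}\mathrm{Ind}_{\mathfrak p}^{\mathfrak p'}=\mathrm{Id}_{\mathfrak p}$; and, with $\tau_{\mathfrak p}^{\mathfrak p'}:=\mathrm{Res}_{\mathfrak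 q}^{\mathfrak p'}\mathrm{Ind}_{\mathfrak p}^{\mathfrak q}$ for any $\mathfrak q\supset\mathfrak p,\mathfrak p'$ (independent of $\mathfrak q$): (2d) $\tau_{\mathfrak p}^{\mathfrak p''}=\tau_{\mathfrak p'}^{\mathfrak p''}\tau_{\mathfrak p}^{\mathfrak p'}$ for collinear $(\mathfrak p,\mathfrak p',\mathfrak p'')$; (2e) if $\mathfrak p'\subset\mathfrak p\supset\mathfrak p''$, $C_{\mathfrak p'}\supset C_{\mathfrak p}\subset C_{\mathfrak p''}$ are of codimension $1$ and $C_{\mathfrak p'},C_{\mathfrak p''}$ have the same linear span and lie on opposite sides of $C_{\mathfrak p}$ in it, then $\tau_{\mathfrak p'}^{\mathfrak p''}$ and $\tau_{\mathfrak p''}^{\mathfrak p'}$ are invertible. **The category $\mathcal C=\mathcal Q^W$.** $W$ acts strictly on $\mathcal Q$ by $w\cdot\mathrm{Ind}_{\mathfrak q}^{\mathfrak p}=\mathrm{Ind}_{w\mathfrak q}^{w\mathfrak p}$, $w\cdot\mathrm{Res}_{\mathfrak p}^{\mathfrak q}=\mathrm{Res}_{w\mathfrak p}^{w\mathfrak q}$. Objects of $\mathcal C$ are $W$-orbits on $\mathcal P_{G,T}$; $\mathrm{Hom}_{\mathcal C}(O_1,O_2)=\bigl(\bigoplus_{\mathfrak p_i\in O_i}\mathrm{Hom}_{\mathcal Q}(\mathfrak p_1,\mathfrak p_2)\bigr)^W$ with composition $(b\circ a)_{\mathfrak p_1,\mathfrak p_3}=\sum_{\mathfrak p_2\in O_2}b_{\mathfrak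 p_2,\mathfrak p_3}a_{\mathfrak p_1,\mathfrak p_2}$. For $a\in\mathrm{Hom}_{\mathcal Q}(\mathfrak p_1,\mathfrak p_2)$ its average is $\underline a=\frac{1}{|\mathrm{Stab}(\mathfrak p_1,\mathfrak p_2)|}\sum_{w\in W}wa\in\mathrm{Hom}_{\mathcal C}(W\mathfrak p_1,W\mathfrak p_2)$, where $wa$ lies in the summand labelled $(w\mathfrak p_1,w\mathfrak p_2)$ and $\mathrm{Stab}(\mathfrak p_1,\mathfrak p_2)\subset W$ is the stabilizer of the pair; $\underline{\mathrm{Ind}},\underline{\mathrm{Res}},\underline\tau$ denote the averages of $\mathrm{Ind},\mathrm{Res},\tau$. *)

(* Defs.v *)
From HB Require Import structures.
From mathcomp Require Import all_boot all_order all_algebra all_fingroup.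
From mathcomp Require Import all_classical all_reals.
From mathcomp Require Import complex.

Set Implicit Arguments.
Unset Strict Implicit.
Unset Printing Implicit Defensive.
Import Order.TTheory GRing.Theory Num.Theory.
Local Open Scope ring_scope.
Local Open Scope complex_scope.

Record lieAlgebra (K : fieldType) := LieAlgebra {
  lie_sort :> vectType K;
  ad : 'Hom(lie_sort, 'End(lie_sort));
  ad_alt : forall x, ad x x = 0;
  ad_jacobi : forall x y z, ad x (ad y z) = ad (ad x y) z + ad y (ad x z) }.

Arguments ad {K} _.

Section LieAlgebra.
Variables (K : fieldType) (L : lieAlgebra K).
Implicit Types U V : {vspace L}.

Definition lie_closed V := forall x y : L, x \in V -> y \in V -> ad L x y \in V.

Definition lie_ideal V := forall x y : L, y \in V -> ad L x y \in V.

Definition derived V : {vspace L} :=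
  <<[seq ad L x y | x <- vbasis V, y <- vbasis V]>>%VS.

Definition lie_solvable V := exists n, iter n derived V = 0%VS.

(* The radical (the largest solvable ideal) is the centre. *)
Definition lie_reductive := forall V, lie_ideal V -> lie_solvable V ->
  forall x y : L, x \in V -> ad L x y = 0.

End LieAlgebra.

(* {x | [y, x] = a(y) x for all y in h}; it is enough to test a basis of h. *)
HB.lock Definition weight_space (K : fieldType) (L : lieAlgebra K)
    (h : {vspace L}) (a : 'Hom(subvs_of h, K^o)) : {vspace L} :=
  (\bigcap_(i < \dim {:subvs_of h})
     lker (ad L (vsval (vbasis {:subvs_of h})`_i)
           - (a (vbasis {:subvs_of h})`_i : K) *: \1%VF))%VS.

Section WeightSpace.
Variables (K : fieldType) (L : lieAlgebra K).

Lemma mem_bigcapv (n : nat) (F : 'I_n -> {vspace L}) (x : L) :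
  reflect (forall i, x \in F i) (x \in \bigcap_(i < n) F i)%VS.
Proof.
apply: (iffP idP) => [xF i|xF].
  by move: x xF; apply/subvP/bigcapv_inf.
by rewrite memvE; apply/subv_bigcapP => i _; rewrite -memvE.
Qed.

Lemma weight_spaceP (h : {vspace L}) (a : 'Hom(subvs_of h, K^o)) (x : L) :
  reflect (forall y : subvs_of h, ad L (vsval y) x = (a y : K) *: x)
          (x \in weight_space a).
Proof.
rewrite weight_space.unlock; apply: (iffP (mem_bigcapv _ _)) => [H y|H i]; last first.
  rewrite memv_ker add_lfunE opp_lfunE scale_lfunE id_lfunE H.
  by rewrite subrr.
rewrite (coord_vbasis (memvf y)) !linear_sum /= !sum_lfunE scaler_suml.
apply: eq_bigr => i _; rewrite !linearZ /= scale_lfunE -scalerA; congr (_ *: _).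
have := H i; rewrite memv_ker add_lfunE opp_lfunE scale_lfunE id_lfunE.
by rewrite subr_eq0 => /eqP.
Qed.

End WeightSpace.

(* The pair (g, h) = (Lie G, Lie T) for a connected complex reductive group G  *)
(* with maximal torus T: a finite-dimensional reductive complex Lie algebra    *)
(* with a self-centralizing subalgebra h acting diagonalizably, its root       *)
(* decomposition, and the real form h_R of h.  The roots are indexed by the    *)
(* finite type rootI.  The fields dim_root_space, ad_root_space, coroot_sl2,   *)
(* root_coroot, root_int and refl_lift state standard facts of structure       *)
(* theory which hold for every such (G, T); in refl_lift, theta is Ad n for    *)
(* n in N_G(T) representing the reflection s_alpha in W = N_G(T)/T.            *)
Record reductivePair (R : realType) := ReductivePair {
  rp_lie :> lieAlgebra R[i];
  rp_reductive : lie_reductive rp_lie;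
  cartan : {vspace rp_lie};
  cartan_centralizer : weight_space (0 : 'Hom(subvs_of cartan, R[i]^o)) = cartan;
  rootI : finType;
  root : rootI -> 'Hom(subvs_of cartan, R[i]^o);
  root_inj : injective root;
  rootP : forall a : 'Hom(subvs_of cartan, R[i]^o),
    (exists i, root i = a) <-> (a <> 0 /\ weight_space a <> 0%VS);
  root_decomposition :
    (cartan + \sum_(i : rootI) weight_space (root i))%VS = fullv;
  dim_root_space : forall i, \dim (weight_space (root i)) = 1%N;
  ad_root_space : forall i j k, root k = root i + root j ->
    exists x y, [/\ x \in weight_space (root i), y \in weight_space (root j)
                   & ad rp_lie x y <> 0];
  hR : vectType R;
  hR_incl : hR -> subvs_of cartan;
  hR_incl_linear : forall (a : R) (x y : hR),
    hR_incl (a *: x + y) = a%:C *: hR_incl x + hR_incl y;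
  hR_real_form : forall z : subvs_of cartan, exists! xy : hR * hR,
    z = hR_incl xy.1 + 'i *: hR_incl xy.2;
  root_real : forall i x, (root i (hR_incl x) : R[i]) \is Num.real;
  coroot : rootI -> hR;
  coroot_sl2 : forall i, exists e f : rp_lie,
    [/\ e \in weight_space (root i), f \in weight_space (- root i)
      & ad rp_lie e f = vsval (hR_incl (coroot i))];
  root_coroot : forall i, root i (hR_incl (coroot i)) = 2;
  root_int : forall i j, exists n : int, root j (hR_incl (coroot i)) = n%:~R;
  refl_lift : forall i, exists theta : 'End(rp_lie),
    [/\ lker theta = 0%VS,
        forall x y, theta (ad rp_lie x y) = ad rp_lie (theta x) (theta y)
      & forall y : subvs_of cartan, theta (vsval y)
          = vsval (y - (root i y : R[i]) *: hR_incl (coroot i))] }.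

Section RealForm.
Variables (R : realType) (D : reductivePair R).
Local Notation I := (rootI D).
Implicit Types (V : {vspace D}) (i j : I).

Definition root_space i : {vspace D} := weight_space (root i).

Definition rootR i (x : hR D) : R := complex.Re (root i (hR_incl x) : R[i]).

Lemma rootRE i x : (root i (hR_incl x) : R[i]) = (rootR i x)%:C.
Proof. by rewrite /rootR RRe_real // root_real. Qed.

Lemma rootR_linear i a x y : rootR i (a *: x + y) = a * rootR i x + rootR i y.
Proof.
rewrite /rootR hR_incl_linear linearP /=.
case: (root i (hR_incl x) : R[i]) => u v; case: (root i (hR_incl y) : R[i]) => w t.
by rewrite /= mul0r subr0.
Qed.

Lemma rootR_coroot i : rootR i (coroot i) = 2.
Proof. by rewrite /rootR root_coroot. Qed.

Definition regular (x : hR D) := forall i, rootR i x <> 0.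

(* The Borel subalgebra of (g, h) attached to the positive system of a regular *)
(* element (Bourbaki, Lie VIII, par. 3).                                       *)
Definition borel (x : hR D) : {vspace D} :=
  (cartan D + \sum_(i | (0 < rootR i x)%R) root_space i)%VS.

(* Parabolic subalgebras of (g, h): the subalgebras of g containing a Borel    *)
(* subalgebra of (g, h); in particular they contain h.                         *)
Definition is_par V := lie_closed V /\ exists2 x, regular x & (borel x <= V)%VS.


Lemma regular_exists : exists x, regular x.
Proof.
suff H (s : seq I) : exists x, forall i, i \in s -> rootR i x != 0.
  have [x Hx] := H (enum I); exists x => i; apply/eqP/Hx; exact: mem_enum.
elim: s => [|j s [x Hx]]; first by exists 0.
have [xj|xj] := eqVneq (rootR j x) 0; last first.
  by exists x => i; rewrite inE => /orP[/eqP->|/Hx].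
pose f i := `|rootR i (coroot j)| / `|rootR i x|.
pose t := (1 + \sum_(i <- s) f i)^-1.
have f0 i : 0 <= f i by rewrite divr_ge0.
have s0 : 0 <= \sum_(i <- s) f i by apply: sumr_ge0.
have t0 : 0 < t by rewrite invr_gt0 ltr_wpDr.
exists (t *: coroot j + x) => i; rewrite inE => /predU1P[->|si].
  by rewrite rootR_linear xj addr0 rootR_coroot mulf_neq0 ?gt_eqF.
have xi := Hx _ si.
have : `|t * rootR i (coroot j)| < `|rootR i x|.
  rewrite normrM gtr0_norm // mulrC ltr_pdivrMr ?ltr_wpDr //.
  rewrite -ltr_pdivrMl ?normr_gt0 // mulrC -/(f i).
  apply: (@le_lt_trans _ _ (\sum_(i <- s) f i)); last by rewrite ltrDr.
  by rewrite (big_rem i) //= lerDl sumr_ge0.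
apply: contraTneq; rewrite rootR_linear => /eqP.
by rewrite addr_eq0 => /eqP ->; rewrite normrN ltxx.
Qed.

Lemma is_par_full : is_par fullv.
Proof.
split; first by move=> *; rewrite memvf.
by have [x xr] := regular_exists; exists x => //; rewrite subvf.
Qed.

Lemma par_cartan V : is_par V -> (cartan D <= V)%VS.
Proof. by case=> _ [x _ sV]; apply: subv_trans sV; apply: addvSl. Qed.

Definition roots_of V : {set I} := [set i | (root_space i <= V)%VS].

Definition subspace_of (S : {set I}) : {vspace D} :=
  (cartan D + \sum_(i in S) root_space i)%VS.

Lemma dim_rspace i : \dim (root_space i) = 1%N.
Proof. exact: dim_root_space. Qed.

Lemma root_space_line i (x : D) : x \in root_space i -> x != 0 ->
  root_space i = <[x]>%VS.
Proof.
move=> xi x0; apply/eqP; rewrite eq_sym eqEdim dim_rspace dim_vline x0.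
by rewrite -memvE xi.
Qed.

Lemma par_weights V : is_par V -> subspace_of (roots_of V) = V.
Proof.
move=> parV; have hV := par_cartan parV; apply/eqP; rewrite eqEsubv; apply/andP; split.
  rewrite subv_add hV /=; apply/subv_sumP => i; by rewrite inE.
have stab (y : subvs_of (cartan D)) (x : D) : x \in V -> ad D (vsval y) x \in V.
  by move=> xV; case: parV => + _; apply => //; apply: (subvP hV); apply: subvsP.
have key (s : seq I) (v : I -> D) : uniq s -> (forall i, v i \in root_space i) ->
    \sum_(i <- s) v i \in V -> forall i, i \in s -> v i \in V.
  elim: s v => [//|j s IHs] v /= /andP[js us] vi; rewrite big_cons => vV.
  have sV i : i \in s -> v i \in V.
    move=> si; have ij : root i <> root j.
      by move/root_inj => eij; rewrite -eij si in js.
    have [y dy] : exists y, (root i y : R[i]) - (root j y : R[i]) != 0.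
      apply: contrapT => H; apply: ij; apply/lfunP => y; apply/eqP.
      rewrite -subr_eq0; apply/negP => /negP dy; apply: H; by exists y.
    pose c (l : I) := (root l y : R[i]) - (root j y : R[i]).
    have H l : l \in s -> c l *: v l \in V.
      apply: (IHs (fun l => c l *: v l)) => // [l'|].
        by rewrite memvZ.
      have -> : \sum_(l <- s) c l *: v l =
          ad D (vsval y) (v j + \sum_(l <- s) v l)
          - (root j y : R[i]) *: (v j + \sum_(l <- s) v l).
        rewrite linearD linear_sum /= scalerDr scaler_sumr.
        rewrite (weight_spaceP _ _ (vi j)) opprD addrACA subrr add0r -sumrB.
        by apply: eq_bigr => m _; rewrite (weight_spaceP _ _ (vi m)) scalerBl.
      by rewrite memvB ?stab ?memvZ.
    have := H _ si; rewrite /c => /(memvZ (c i)^-1).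
    by rewrite scalerA mulVf // scale1r.
  move=> i; rewrite inE => /predU1P[->|]; last exact: sV.
  have := memvB vV (_ : \sum_(l <- s) v l \in V); rewrite addrK; apply.
  by rewrite big_seq memv_suml.
apply/subvP => x xV; have : x \in fullv by rewrite memvf.
rewrite -root_decomposition => /memv_addP[y yh [_ /memv_sumP[v vi ->]] xE].
have vV i : v i \in V.
  apply: (key (index_enum I) v (index_enum_uniq _)) => [l||].
  - exact: vi.
  - have -> : \sum_i v i = x - y by rewrite xE addrC addKr.
    by rewrite memvB // (subvP hV).
  - exact: mem_index_enum.
rewrite xE memv_add // (bigID [in roots_of V]) /= [X in _ + X]big1 ?addr0.
  by apply: memv_sumr => i _; apply: vi.
move=> i; rewrite inE => /negP iV; apply/eqP/negPn/negP => vi0; apply: iV.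
by rewrite (root_space_line (vi i _) vi0) // -memvE.
Qed.

Record par := Par { par_space :> {vspace D}; par_subproof : `[< is_par par_space >] }.
HB.instance Definition _ := [isSub for par_space].
HB.instance Definition _ := [Choice of par by <:].

Lemma parP (p : par) : is_par p.
Proof. exact/asboolP/par_subproof. Qed.

Definition par_of_set (S : {set I}) : option par := insub (subspace_of S).

Lemma par_setK : pcancel (fun p : par => roots_of p) par_of_set.
Proof. by move=> p; rewrite /par_of_set par_weights ?valK //; apply: parP. Qed.

HB.instance Definition _ := Countable.copy par (pcan_type par_setK).
HB.instance Definition _ : isFinite par := PCanIsFinite par_setK.

End RealForm.

Section Weyl.
Variables (R : realType) (D : reductivePair R).
Local Notation I := (rootI D).
Implicit Types (i j : I) (p q r : par D).

(* The permutations of the roots induced by the reflections s_alpha.           *)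
Definition reflections : {set {perm I}} :=
  [set w : {perm I} | [exists i, [forall j, root (w j) ==
     root j - (root j (hR_incl (coroot i)) : R[i]) *: root i]]].

Definition weyl_group : {group {perm I}} := <<reflections>>%G.

(* The Weyl group, as a group of permutations of the roots (its action on the  *)
(* roots is faithful).  Beware that the product of permutations is in the      *)
(* diagrammatic order: (v * w)%g acts as v followed by w.                      *)
Definition weyl := subg_of weyl_group.

Definition realized (w : {perm I}) :=
  (exists theta : 'End(D),
    [/\ lker theta = 0%VS,
        forall x y, theta (ad D x y) = ad D (theta x) (theta y),
        (theta @: cartan D = cartan D)%VS
      & forall j, (theta @: root_space j = root_space (w j))%VS]) /\
  (exists phi : 'End(hR D), lker phi = 0%VS /\
    forall j x, rootR (w j) (phi x) = rootR j x).

Lemma weyl_realized : forall w : {perm I}, w \in weyl_group -> realized w.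
Proof.
pose G := [set w : {perm I} | `[< realized w >] ].
have gG : group_set G.
  apply/group_setP; split.
    rewrite inE; apply/asboolP; split.
      exists \1%VF; split => [|x y||j]; rewrite ?lker0_lim ?lim1g ?perm1 //.
        by apply/eqP/lker0P => x y; rewrite !id_lfunE.
      by rewrite !id_lfunE.
    exists \1%VF; split; first by apply/eqP/lker0P => x y; rewrite !id_lfunE.
    by move=> j x; rewrite perm1 id_lfunE.
  move=> v w; rewrite !inE => -[[t [t0 tL th tr]] [f [f0 fr]]].
  move=> [[t' [t0' tL' th' tr']] [f' [f0' fr']]].
  split.
    exists (t' \o t)%VF; split.
    - apply/eqP/lker0P => x y; rewrite !comp_lfunE.
      by move/(lker0P (introT eqP t0')); apply: (lker0P (introT eqP t0)).
    - by move=> x y; rewrite !comp_lfunE tL tL'.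
    - by rewrite limg_comp th th'.
    - by move=> j; rewrite limg_comp tr tr' permM.
  exists (f' \o f)%VF; split.
    apply/eqP/lker0P => x y; rewrite !comp_lfunE.
    by move/(lker0P (introT eqP f0')); apply: (lker0P (introT eqP f0)).
  by move=> j x; rewrite permM comp_lfunE fr' fr.
suff /fintype.subsetP H : weyl_group \subset G by move=> w /H; rewrite inE => /asboolP.
rewrite -[G]/(gval (group gG)) gen_subG; apply/fintype.subsetP => w.
rewrite inE => /existsP[i /forallP wi]; rewrite inE; apply/asboolP.
have {}wi j : root (w j) = root j - (root j (hR_incl (coroot i)) : R[i]) *: root i.
  by apply/eqP.
split.
  have [t [t0 tL ty]] := refl_lift i; exists t.
  have inj_t : injective t by apply/lker0P/eqP.
  have dim_t U : \dim (t @: U) = \dim U by rewrite limg_dim_eq // t0 capv0.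
  have th : (t @: cartan D = cartan D)%VS.
    apply/eqP; rewrite eqEdim dim_t leqnn andbT.
    apply/subvP => _ /memv_imgP[y yh ->].
    by rewrite -(vsprojK yh) ty subvsP.
  split; [exact: t0 | exact: tL | exact: th |] => j; apply/eqP.
  rewrite eqEdim dim_t !dim_rspace leqnn andbT.
  apply/subvP => _ /memv_imgP[x xj ->]; apply/weight_spaceP => y.
  pose z := y - (root i y : R[i]) *: hR_incl (coroot i).
  have zy : t (vsval z) = vsval y.
    rewrite ty; congr vsval.
    have -> : (root i z : R[i]) = - (root i y : R[i]).
      rewrite /z linearB linearZ /= root_coroot.
      change (root i y - (root i y : R[i]) * 2 = - root i y :> R[i]).
      by rewrite mulr_natr mulr2n opprD addrA subrr add0r.
    by rewrite /z scaleNr opprK subrK.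
  rewrite -zy -tL (weight_spaceP _ _ xj) linearZ /=; congr (_ *: _).
  rewrite wi add_lfunE opp_lfunE scale_lfunE /z linearB linearZ /=.
  by congr (_ - _); apply: mulrC.
pose f x := x - rootR i x *: coroot i.
have fL : linear f.
  move=> a x y; rewrite /f rootR_linear scalerDl scalerBr scalerA opprD.
  by rewrite addrACA.
pose fM := GRing.isLinear.Build _ _ _ _ f fL.
pose fLin : {linear hR D -> hR D} := HB.pack f fM.
have fE x : linfun fLin x = f x by rewrite lfunE.
have fK x : f (f x) = x.
  rewrite {1}/f; have -> : rootR i (f x) = - rootR i x.
    rewrite /f addrC -scaleNr rootR_linear rootR_coroot mulr_natr mulr2n.
    by rewrite -addrA addNr addr0.
  by rewrite scaleNr opprK subrK.
exists (linfun fLin); split.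
  by apply/eqP/lker0P => x y; rewrite !fE => /(congr1 f); rewrite !fK.
move=> j x; rewrite fE.
have -> y : rootR (w j) y = rootR j y - rootR j (coroot i) * rootR i y.
  apply: complexI; rewrite -rootRE wi add_lfunE opp_lfunE scale_lfunE.
  by rewrite !rootRE rmorphB rmorphM /=; congr (_ - _ * _); rewrite rootRE.
have fx k : rootR k (f x) = rootR k x - rootR i x * rootR k (coroot i).
  by rewrite /f addrC -scaleNr rootR_linear addrC mulNr.
rewrite !fx rootR_coroot mulr_natr mulr2n opprD addrA subrr add0r mulrN opprK.
by rewrite [rootR i x * _]mulrC subrK.
Qed.

(* This is Ad n (p) for any n in N_G(T) representing w (see wspaceE): p is the *)
(* sum of h and of the root spaces it contains (par_weights).                  *)
Definition wspace (w : weyl) p : {vspace D} :=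
  (cartan D + \sum_(i in roots_of p) root_space (sgval w i))%VS.

Lemma wspaceE (w : weyl) : exists theta : 'End(D),
  [/\ lker theta = 0%VS,
      forall x y, theta (ad D x y) = ad D (theta x) (theta y)
    & forall p, wspace w p = (theta @: p)%VS].
Proof.
have [[t [t0 tL th tr]] _] := weyl_realized (valP w).
exists t; split=> // p; rewrite -{1}(par_weights (parP p)) limgD th limg_sum.
by congr (_ + _)%VS; apply: eq_bigr => i _; rewrite tr.
Qed.

Lemma wspace_par (w : weyl) p : `[< is_par (wspace w p) >].
Proof.
apply/asboolP; have [[t [t0 tL th tr]] [f [f0 fr]]] := weyl_realized (valP w).
have -> : wspace w p = (t @: p)%VS.
  rewrite -{1}(par_weights (parP p)) limgD th limg_sum.
  by congr (_ + _)%VS; apply: eq_bigr => i _; rewrite tr.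
have [pL [x xr xp]] := parP p; split.
  move=> _ _ /memv_imgP[y yp ->] /memv_imgP[z zp ->]; rewrite -tL memv_img //.
  exact: pL.
exists (f x) => [i|]; first by rewrite -(permKV (sgval w) i) fr; apply: xr.
apply: subv_trans (limgS t xp); rewrite limgD th limg_sum addvS //.
rewrite (reindex_inj (@perm_inj _ (sgval w))) /=.
by under eq_bigl do rewrite fr; under [X in (_ <= X)%VS]eq_bigr do rewrite tr.
Qed.

Definition wact (w : weyl) p : par D := Par (wspace_par w p).

Definition par_top : par D := Par (asboolT (is_par_full D)).

Lemma par_topP p : (p <= par_top)%VS. Proof. exact: subvf. Qed.

Lemma wactS (w : weyl) p q : (p <= q)%VS -> (wact w p <= wact w q)%VS.
Proof.
by move=> pq /=; have [t [_ _ tE]] := wspaceE w; rewrite !tE limgS.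
Qed.

Lemma mem_roots_wact (w : weyl) p i :
  (sgval w i \in roots_of (wact w p)) = (i \in roots_of p).
Proof.
have [[t [t0 tL th tr]] [f [f0 fr]]] := weyl_realized (valP w).
have ti : injective t by apply/lker0P/eqP.
have wE : wspace w p = (t @: p)%VS.
  rewrite -{1}(par_weights (parP p)) limgD th limg_sum.
  by congr (_ + _)%VS; apply: eq_bigr => j _; rewrite tr.
rewrite !inE [par_space _]/= wE -tr; apply/idP/idP => [H|]; last exact: limgS.
by apply/subvP => x xi; have /(subvP H)/memv_imgP[y yp /ti ->] := memv_img t xi.
Qed.

Lemma par_eq p q : roots_of p = roots_of q -> p = q.
Proof.
by move=> e; apply: val_inj; rewrite /= -(par_weights (parP p)) e (par_weights (parP q)).
Qed.

Lemma weyl_permM (v w : weyl) i : sgval (v * w)%g i = sgval w (sgval v i).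
Proof. exact: permM. Qed.

Lemma wactM (v w : weyl) p : wact w (wact v p) = wact (v * w)%g p.
Proof.
have surj (u : weyl) i : exists j, i = sgval u j.
  by exists ((sgval u)^-1%g i); rewrite permKV.
apply: par_eq; apply/setP => i; have [j ->] := surj w i; have [l ->] := surj v j.
transitivity (l \in roots_of p).
  exact: etrans (mem_roots_wact w _ _) (mem_roots_wact v _ _).
by rewrite -weyl_permM; apply: esym (mem_roots_wact _ _ _).
Qed.

Lemma wact1 p : wact 1%g p = p.
Proof.
apply: par_eq; apply/setP => i.
have e : sgval (1%g : weyl) i = i by exact: perm1.
by rewrite -{1}e mem_roots_wact.
Qed.

Definition worbit p : {set par D} := [set wact w p | w : weyl].

Definition wstab p : {set weyl} := [set w | wact w p == p].

Lemma worbit_refl p : p \in worbit p.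
Proof. by apply/imsetP; exists 1%g; rewrite ?wact1. Qed.

Lemma worbit_wact (w : weyl) p : worbit (wact w p) = worbit p.
Proof.
apply/setP => q; apply/imsetP/imsetP => -[v _ ->].
  by exists (w * v)%g; rewrite ?wactM.
by exists (w^-1 * v)%g; rewrite // wactM mulKVg.
Qed.

Lemma worbit_mem (w : weyl) p q : (wact w p \in worbit q) = (p \in worbit q).
Proof.
apply/imsetP/imsetP => -[v _ e].
  exists (v * w^-1)%g => //; apply: (can_inj (g := wact w^-1%g) (f := wact w)).
    by move=> r; rewrite wactM mulgV wact1.
  by rewrite wactM -mulgA mulVg mulg1.
by exists (v * w)%g; rewrite // -wactM e.
Qed.

End Weyl.

Section ConvexSets.
Local Open Scope classical_set_scope.
Variables (R : realType) (V : vectType R).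
Implicit Types (A B : set V).

Definition linspan A : set V :=
  [set v | forall U : {vspace V}, (forall a, A a -> a \in U) -> v \in U].

(* Relative interior of a convex set containing 0: its affine hull is then its *)
(* linear span, and topological and radial interiors of a convex set agree in  *)
(* finite dimension.                                                           *)
Definition relint A : set V :=
  [set x | A x /\ forall v, linspan A v ->
     exists2 eps : R, 0 < eps & forall t : R, `|t| <= eps -> A (x + t *: v)].

Definition codim1 A B := exists U U' : {vspace V},
  [/\ linspan A = [set` U], linspan B = [set` U'] & \dim U' = (\dim U).+1].

Definition segment (a c : V) (t : R) : V := (1 - t) *: a + t *: c.

Section Transport.
Variables (phi : 'End(V)) (phi0 : lker phi = 0%VS).

Lemma inj_phi : injective phi. Proof. exact/lker0P/eqP. Qed.

Lemma surj_phi y : exists x, y = phi x.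
Proof.
have e : (phi @: fullv)%VS = fullv.
  by apply/eqP; rewrite eqEdim subvf limg_dim_eq ?leqnn // phi0 capv0.
have : y \in (phi @: fullv)%VS by rewrite e memvf.
by case/memv_imgP => x _ ->; exists x.
Qed.

Variables (A B : set V) (AB : forall x, B (phi x) <-> A x).

Lemma linspan_phi v : linspan B (phi v) <-> linspan A v.
Proof.
split=> Hv U HU.
  have : phi v \in (phi @: U)%VS.
    apply: Hv => y; have [x ->] := surj_phi y; rewrite AB => /HU xU.
    exact: memv_img.
  by case/memv_imgP => x xU /inj_phi ->.
rewrite memv_preim; apply: Hv => a Aa; rewrite -memv_preim.
exact/HU/AB.
Qed.

Lemma relint_phi x : relint B (phi x) <-> relint A x.
Proof.
split=> -[Ax H]; split; try exact/AB.
  move=> v Av; have [e e0 He] := H (phi v) (proj2 (linspan_phi v) Av).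
  by exists e => // t /He; rewrite -linearZ -linearD AB.
move=> y; have [v ->] := surj_phi y; rewrite linspan_phi => Av.
have [e e0 He] := H v Av.
by exists e => // t /He; rewrite -linearZ -linearD AB.
Qed.

Lemma linspan_phiE (U : {vspace V}) : linspan A = [set` U] -> linspan B = [set` (phi @: U)%VS].
Proof.
move=> e; apply/seteqP; split=> y /=; have [x ->] := surj_phi y.
  by move=> /linspan_phi; rewrite e; apply: memv_img.
by case/memv_imgP => x' x'U /inj_phi ->; apply/linspan_phi; rewrite e.
Qed.

Lemma dim_phi (U : {vspace V}) : \dim (phi @: U) = \dim U.
Proof. by rewrite limg_dim_eq // phi0 capv0. Qed.

End Transport.
End ConvexSets.

Section Cells.
Local Open Scope classical_set_scope.
Variables (R : realType) (D : reductivePair R).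
Local Notation I := (rootI D).
Local Notation V := (hR D).
Implicit Types (p q r : par D).

Definition cell p : set V :=
  [set x | forall i, i \in roots_of p -> 0 <= rootR i x].

Definition collinear p p' p'' := exists a b c : V, exists t : R,
  [/\ relint (cell p) a, relint (cell p') b, relint (cell p'') c,
      0 <= t <= 1 & b = segment a c t].

(* The inclusions of parabolics give those of cells, C_p in C_p' and C_p''; a   *)
(* linear form f vanishing on C_p separates the two sides of C_p in the common *)
(* span of C_p' and C_p''.                                                     *)
Definition opposite_along p p' p'' :=
  [/\ (p' <= p)%VS, (p'' <= p)%VS,
      codim1 (cell p) (cell p') /\ codim1 (cell p) (cell p''),
      linspan (cell p') = linspan (cell p'')
    & exists f : 'Hom(V, R^o),
      [/\ forall x, cell p x -> f x = 0,
          forall x, relint (cell p') x -> 0 < (f x : R)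
        & forall x, relint (cell p'') x -> (f x : R) < 0]].

Definition opposite p' p'' := exists p, opposite_along p p' p''.

Definition levi p : {vspace D} :=
  (cartan D + \sum_(i in roots_of p | [exists j in roots_of p, root j == - root i])
                root_space i)%VS.

Definition levi_zero p q : set V :=
  [set x | forall i, i \in roots_of (levi p :&: levi q)%VS -> rootR i x = 0].

(* r is the first face open in levi_zero p q met by any segment from a point   *)
(* of the cell of p to a point of the cell of q.  A face is open in the space  *)
(* H iff it spans H.                                                           *)
Definition first_chamber p q r :=
  linspan (cell r) = levi_zero p q /\
  forall a c, relint (cell p) a -> relint (cell q) c ->
    exists t0 : R, [/\ 0 <= t0 <= 1, relint (cell r) (segment a c t0)
      & forall (t : R) s, 0 <= t <= t0 -> linspan (cell s) = levi_zero p q ->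
          relint (cell s) (segment a c t) -> s = r].

(* The Tits product.  There is a unique r with first_chamber p q r, and it is  *)
(* contained in p; that inclusion is recorded in the choice so that Ind and    *)
(* Res between tits p q and p can be formed.                                   *)
Definition tits p q : par D := xget p [set r | first_chamber p q r /\ (r <= p)%VS].

Lemma tits_sub p q : (tits p q <= p)%VS.
Proof. by rewrite /tits; case: xgetP => [r _ []|]. Qed.

Lemma cell_wact (w : weyl D) : exists phi : 'End(V), lker phi = 0%VS /\
  forall p x, cell (wact w p) (phi x) <-> cell p x.
Proof.
have [_ [f [f0 fr]]] := weyl_realized (valP w); exists f; split=> // p x.
have surj i : exists j, i = sgval w j.
  by exists ((sgval w)^-1%g i); rewrite permKV.
split=> H i ip; first by rewrite -(fr i); apply: H; rewrite mem_roots_wact.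
have [j e] := surj i; rewrite e fr; apply: H.
by rewrite e mem_roots_wact in ip.
Qed.

Lemma collinear_wact (w : weyl D) p p' p'' :
  collinear p p' p'' -> collinear (wact w p) (wact w p') (wact w p'').
Proof.
have [f [f0 fc]] := cell_wact w.
move=> [a [b [c [t [pa pb pc t01 bE]]]]].
exists (f a), (f b), (f c), t.
split=> //; try exact/(relint_phi f0 (fc _)).
by rewrite bE /segment linearD !linearZ.
Qed.

Lemma codim1_wact (w : weyl D) p p' :
  codim1 (cell p) (cell p') -> codim1 (cell (wact w p)) (cell (wact w p')).
Proof.
have [f [f0 fc]] := cell_wact w => -[U [U' [UE U'E d]]].
exists (f @: U)%VS, (f @: U')%VS; split; last by rewrite !dim_phi.
  exact: linspan_phiE UE.
exact: linspan_phiE U'E.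
Qed.

Lemma opposite_wact (w : weyl D) p' p'' :
  opposite p' p'' -> opposite (wact w p') (wact w p'').
Proof.
have [f [f0 fc]] := cell_wact w.
move=> [p [pp' pp'' [c' c''] e [g [g0 g1 g2]]]]; exists (wact w p).
split; [exact: wactS | exact: wactS | split; exact: codim1_wact | |].
  apply/seteqP; split=> y; have [x ->] := surj_phi f0 y.
    by rewrite !(linspan_phi f0 (fc _)) e.
  by rewrite !(linspan_phi f0 (fc _)) e.
have fK x : (f^-1)%VF (f x) = x by rewrite lker0_lfunK //; apply/eqP.
exists (g \o f^-1)%VF; split=> y; have [x ->] := surj_phi f0 y;
  rewrite comp_lfunE fK.
- by rewrite fc; apply: g0.
- by rewrite (relint_phi f0 (fc _)); apply: g1.
- by rewrite (relint_phi f0 (fc _)); apply: g2.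
Qed.

End Cells.

(* The double incidence category: its morphisms are the formal terms modulo    *)
(* the smallest k-linear congruence containing the relations.                  *)
Section Terms.
Local Open Scope quotient_scope.
Variables (k : fieldType) (R : realType) (D : reductivePair R).
Local Notation P := (par D).
Implicit Types (p q r : P).

(* TInv adjoins the inverse of tau required between opposite cells.            *)
Inductive term : P -> P -> Type :=
| TId p : term p p
| TComp p q r : term q r -> term p q -> term p r
| TZero p q : term p q
| TAdd p q : term p q -> term p q -> term p q
| TScale p q : k -> term p q -> term p q
| TInd p p' : (p <= p')%VS -> term p p'
| TRes p p' : (p <= p')%VS -> term p' p
| TInv p' p'' : opposite p' p'' -> term p'' p'.

(* The transition through the largest parabolic g; see TTau_indep for its      *)
(* independence of the choice of a parabolic containing p and p'.              *)
Definition TTau p p' : term p p' :=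
  TComp (TRes (par_topP p')) (TInd (par_topP p)).

Inductive teq : forall p q, term p q -> term p q -> Prop :=
| teq_refl p q (a : term p q) : teq a a
| teq_sym p q (a b : term p q) : teq a b -> teq b a
| teq_trans p q (a b c : term p q) : teq a b -> teq b c -> teq a c
| teq_comp p q r (b b' : term q r) (a a' : term p q) :
    teq b b' -> teq a a' -> teq (TComp b a) (TComp b' a')
| teq_add p q (a a' b b' : term p q) :
    teq a a' -> teq b b' -> teq (TAdd a b) (TAdd a' b')
| teq_scale p q (c : k) (a a' : term p q) :
    teq a a' -> teq (TScale c a) (TScale c a')
| teq_compA p q r s (c : term r s) (b : term q r) (a : term p q) :
    teq (TComp c (TComp b a)) (TComp (TComp c b) a)
| teq_idl p q (a : term p q) : teq (TComp (TId q) a) a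
| teq_idr p q (a : term p q) : teq (TComp a (TId p)) a
| teq_addA p q (a b c : term p q) :
    teq (TAdd a (TAdd b c)) (TAdd (TAdd a b) c)
| teq_addC p q (a b : term p q) : teq (TAdd a b) (TAdd b a)
| teq_add0 p q (a : term p q) : teq (TAdd (TZero p q) a) a
| teq_addN p q (a : term p q) : teq (TAdd (TScale (-1) a) a) (TZero p q)
| teq_scaleA p q (c d : k) (a : term p q) :
    teq (TScale c (TScale d a)) (TScale (c * d) a)
| teq_scale1 p q (a : term p q) : teq (TScale 1 a) a
| teq_scaleDr p q (c : k) (a b : term p q) :
    teq (TScale c (TAdd a b)) (TAdd (TScale c a) (TScale c b))
| teq_scaleDl p q (c d : k) (a : term p q) :
    teq (TScale (c + d) a) (TAdd (TScale c a) (TScale d a))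
| teq_compDl p q r (b b' : term q r) (a : term p q) :
    teq (TComp (TAdd b b') a) (TAdd (TComp b a) (TComp b' a))
| teq_compDr p q r (b : term q r) (a a' : term p q) :
    teq (TComp b (TAdd a a')) (TAdd (TComp b a) (TComp b a'))
| teq_compZl p q r (c : k) (b : term q r) (a : term p q) :
    teq (TComp (TScale c b) a) (TScale c (TComp b a))
| teq_compZr p q r (c : k) (b : term q r) (a : term p q) :
    teq (TComp b (TScale c a)) (TScale c (TComp b a))
| teq_ind_id p (H : (p <= p)%VS) : teq (TInd H) (TId p)
| teq_res_id p (H : (p <= p)%VS) : teq (TRes H) (TId p)
| teq_ind_comp p p' p'' (H : (p <= p')%VS) (H' : (p' <= p'')%VS)
    (H'' : (p <= p'')%VS) : teq (TComp (TInd H') (TInd H)) (TInd H'')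
| teq_res_comp p p' p'' (H : (p <= p')%VS) (H' : (p' <= p'')%VS)
    (H'' : (p <= p'')%VS) : teq (TComp (TRes H) (TRes H')) (TRes H'')
| teq_res_ind p p' (H : (p <= p')%VS) : teq (TComp (TRes H) (TInd H)) (TId p)
| teq_tau p p' p'' : collinear p p' p'' ->
    teq (TTau p p'') (TComp (TTau p' p'') (TTau p p'))
| teq_invl p' p'' (H : opposite p' p'') :
    teq (TComp (TInv H) (TTau p' p'')) (TId p')
| teq_invr p' p'' (H : opposite p' p'') :
    teq (TComp (TTau p' p'') (TInv H)) (TId p'').

Lemma TTau_indep p p' q (H : (p <= q)%VS) (H' : (p' <= q)%VS) :
  teq (TComp (TRes H') (TInd H)) (TTau p p').
Proof.
apply: teq_sym; have Hq := par_topP q.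
apply: teq_trans (teq_comp (teq_sym (teq_res_comp H' Hq _))
                           (teq_sym (teq_ind_comp H Hq _))) _.
apply: teq_trans (teq_sym (teq_compA _ _ _)) _.
apply: teq_comp (teq_refl _) _; apply: teq_trans (teq_compA _ _ _) _.
exact: teq_trans (teq_comp (teq_res_ind Hq) (teq_refl _)) (teq_idl _).
Qed.

Fixpoint tact (w : weyl D) p q (a : term p q) : term (wact w p) (wact w q) :=
  match a with
  | TId p => TId (wact w p)
  | TComp _ _ _ b a => TComp (tact w b) (tact w a)
  | TZero p q => TZero (wact w p) (wact w q)
  | TAdd _ _ a b => TAdd (tact w a) (tact w b)
  | TScale _ _ c a => TScale c (tact w a)
  | TInd _ _ H => TInd (wactS w H)
  | TRes _ _ H => TRes (wactS w H)
  | TInv _ _ H => TInv (opposite_wact w H)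
  end.

Lemma tact_tau (w : weyl D) p p' :
  teq (tact w (TTau p p')) (TTau (wact w p) (wact w p')).
Proof. exact: TTau_indep. Qed.

Lemma tact_teq (w : weyl D) p q (a b : term p q) :
  teq a b -> teq (tact w a) (tact w b).
Proof.
elim=> {p q a b} /=; try by constructor.
- by move=> p q a b c _ + _; apply: teq_trans.
- move=> p p' p'' H; apply: teq_trans (tact_tau w _ _) _.
  apply: teq_trans (teq_tau (collinear_wact w H)) _.
  by apply: teq_comp; apply: teq_sym; apply: tact_tau.
- move=> p p' H; apply: teq_trans (teq_invl (opposite_wact w H)).
  by apply: teq_comp (teq_refl _) _; apply: tact_tau.
- move=> p p' H; apply: teq_trans (teq_invr (opposite_wact w H)).
  by apply: teq_comp _ (teq_refl _); apply: tact_tau.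
Qed.

Definition castT p q p' q' (e : p = p') (f : q = q') (a : term p q) : term p' q' :=
  ecast x (term x q') e (ecast y (term p y) f a).

Lemma tactM (v w : weyl D) p q (a : term p q)
    (e : wact w (wact v p) = wact (v * w)%g p)
    (f : wact w (wact v q) = wact (v * w)%g q) :
  castT e f (tact w (tact v a)) = tact (v * w)%g a.
Proof.
elim: a e f => {p q} /=.
- by move=> p e f; rewrite (eq_irrelevance f e); case: _ / e.
- move=> p q r b IHb a IHa e f.
  rewrite -(IHb (wactM v w q) f) -(IHa e (wactM v w q)).
  by move: (tact w (tact v b)) (tact w (tact v a));
     case: _ / e; case: _ / f; case: _ / (wactM v w q).
- by move=> p q e f; case: _ / e; case: _ / f.
- move=> p q a IHa b IHb e f; rewrite -(IHa e f) -(IHb e f).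
  by move: (tact w (tact v b)) (tact w (tact v a)); case: _ / e; case: _ / f.
- move=> p q c a IHa e f; rewrite -(IHa e f).
  by move: (tact w (tact v a)); case: _ / e; case: _ / f.
- move=> p q H e f; move: (wactS w (wactS v H)) (wactS (v * w)%g H) => H1 H2.
  by case: _ / e H2 => H2; case: _ / f H2 => H2 /=; congr TInd; apply: Prop_irrelevance.
- move=> p q H e f; move: (wactS w (wactS v H)) (wactS (v * w)%g H) => H1 H2.
  by case: _ / e H2 => H2; case: _ / f H2 => H2 /=; congr TRes; apply: Prop_irrelevance.
- move=> p q H e f; move: (opposite_wact w (opposite_wact v H)) (opposite_wact (v * w)%g H) => H1 H2.
  by case: _ / e H2 => H2; case: _ / f H2 => H2 /=; congr TInv; apply: Prop_irrelevance.
Qed.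

HB.instance Definition _ p q := gen_eqMixin (term p q).
HB.instance Definition _ p q := gen_choiceMixin (term p q).

Definition teqb p q : rel (term p q) := fun a b => `[< teq a b >].

Lemma teqb_equiv p q : equiv_class_of (@teqb p q).
Proof.
split=> [a|a b|b a c]; first by apply/asboolP; apply: teq_refl.
  by apply/asboolP/asboolP; apply: teq_sym.
by move=> /asboolP ab /asboolP bc; apply/asboolP/(teq_trans ab).
Qed.

Canonical teqb_equiv_rel p q := EquivRelPack (teqb_equiv p q).

Definition HomQ p q := {eq_quot (teqb_equiv_rel p q)}.
HB.instance Definition _ p q := Choice.on (HomQ p q).

Definition cl p q (a : term p q) : HomQ p q := \pi_({eq_quot (teqb_equiv_rel p q)}) a.

Lemma clP p q (a b : term p q) : cl a = cl b <-> teq a b.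
Proof.
split=> [/eqquotP/asboolP//|H]; by apply/eqquotP/asboolP.
Qed.

Definition rp p q (x : HomQ p q) : term p q := generic_quotient.repr x.

Lemma rpK p q (x : HomQ p q) : cl (rp x) = x.
Proof. exact: reprK. Qed.

Lemma rp_cl p q (a : term p q) : teq (rp (cl a)) a.
Proof. by apply/clP; rewrite rpK. Qed.

Lemma HomQ_ind p q (Q : HomQ p q -> Prop) : (forall a, Q (cl a)) -> forall x, Q x.
Proof. by move=> H x; rewrite -(rpK x). Qed.

Definition addQ p q (x y : HomQ p q) := cl (TAdd (rp x) (rp y)).
Definition zeroQ p q : HomQ p q := cl (TZero p q).
Definition scaleQ p q (c : k) (x : HomQ p q) := cl (TScale c (rp x)).
Definition oppQ p q (x : HomQ p q) := scaleQ (-1) x.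
Definition compQ p q r (y : HomQ q r) (x : HomQ p q) : HomQ p r :=
  cl (TComp (rp y) (rp x)).
Definition actQ (w : weyl D) p q (x : HomQ p q) : HomQ (wact w p) (wact w q) :=
  cl (tact w (rp x)).

Lemma addQE p q (a b : term p q) : addQ (cl a) (cl b) = cl (TAdd a b).
Proof. by apply/clP; apply: teq_add; apply: rp_cl. Qed.
Lemma scaleQE p q c (a : term p q) : scaleQ c (cl a) = cl (TScale c a).
Proof. by apply/clP; apply: teq_scale; apply: rp_cl. Qed.
Lemma compQE p q r (b : term q r) (a : term p q) :
  compQ (cl b) (cl a) = cl (TComp b a).
Proof. by apply/clP; apply: teq_comp; apply: rp_cl. Qed.
Lemma actQE (w : weyl D) p q (a : term p q) : actQ w (cl a) = cl (tact w a).
Proof. by apply/clP; apply: tact_teq; apply: rp_cl. Qed.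

Lemma addQA p q : associative (@addQ p q).
Proof.
elim/HomQ_ind => a; elim/HomQ_ind => b; elim/HomQ_ind => c.
by rewrite !addQE; apply/clP; apply: teq_addA.
Qed.
Lemma addQC p q : commutative (@addQ p q).
Proof.
by elim/HomQ_ind => a; elim/HomQ_ind => b; rewrite !addQE; apply/clP/teq_addC.
Qed.
Lemma add0Q p q : left_id (zeroQ p q) (@addQ p q).
Proof. by elim/HomQ_ind => a; rewrite addQE; apply/clP/teq_add0. Qed.
Lemma addNQ p q : left_inverse (zeroQ p q) (@oppQ p q) (@addQ p q).
Proof.
by elim/HomQ_ind => a; rewrite /oppQ scaleQE addQE; apply/clP/teq_addN.
Qed.
HB.instance Definition _ p q :=
  GRing.isZmodule.Build (HomQ p q) (@addQA p q) (@addQC p q) (@add0Q p q) (@addNQ p q).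

Lemma clD p q (a b : term p q) : cl a + cl b = cl (TAdd a b).
Proof. exact: addQE. Qed.

Lemma scaleQA p q c d (x : HomQ p q) : scaleQ c (scaleQ d x) = scaleQ (c * d) x.
Proof. by elim/HomQ_ind: x => a; rewrite !scaleQE; apply/clP/teq_scaleA. Qed.
Lemma scale1Q p q : left_id 1 (@scaleQ p q).
Proof. by elim/HomQ_ind => a; rewrite !scaleQE; apply/clP/teq_scale1. Qed.
Lemma scaleQDr p q : right_distributive (@scaleQ p q) +%R.
Proof.
move=> c; elim/HomQ_ind => a; elim/HomQ_ind => b.
by rewrite clD !scaleQE clD; apply/clP/teq_scaleDr.
Qed.
Lemma scaleQDl p q (x : HomQ p q) : {morph (@scaleQ p q)^~ x : c d / c + d}.
Proof.
move=> c d; elim/HomQ_ind: x => a.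
by rewrite /= !scaleQE clD; apply/clP/teq_scaleDl.
Qed.
HB.instance Definition _ p q := GRing.Zmodule_isLmodule.Build k (HomQ p q)
  (@scaleQA p q) (@scale1Q p q) (@scaleQDr p q) (@scaleQDl p q).

Lemma clZ p q c (a : term p q) : c *: cl a = cl (TScale c a).
Proof. exact: scaleQE. Qed.

Lemma actQ_add (w : weyl D) p q (x y : HomQ p q) :
  actQ w (x + y) = actQ w x + actQ w y.
Proof.
elim/HomQ_ind: x => a; elim/HomQ_ind: y => b.
by rewrite clD !actQE clD.
Qed.
Lemma actQ_scale (w : weyl D) p q c (x : HomQ p q) :
  actQ w (c *: x) = c *: actQ w x.
Proof.
by elim/HomQ_ind: x => a; rewrite clZ !actQE clZ.
Qed.
Lemma actQ_comp (w : weyl D) p q r (y : HomQ q r) (x : HomQ p q) :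
  actQ w (compQ y x) = compQ (actQ w y) (actQ w x).
Proof.
by elim/HomQ_ind: x => a; elim/HomQ_ind: y => b; rewrite compQE !actQE compQE.
Qed.
Lemma compQZl p q r c (y : HomQ q r) (x : HomQ p q) :
  compQ (c *: y) x = c *: compQ y x.
Proof.
elim/HomQ_ind: x => a; elim/HomQ_ind: y => b.
by rewrite clZ !compQE clZ; apply/clP/teq_compZl.
Qed.
Lemma compQZr p q r c (y : HomQ q r) (x : HomQ p q) :
  compQ y (c *: x) = c *: compQ y x.
Proof.
elim/HomQ_ind: x => a; elim/HomQ_ind: y => b.
by rewrite clZ !compQE clZ; apply/clP/teq_compZr.
Qed.
Lemma comp0Q p q r (x : HomQ p q) : compQ (0 : HomQ q r) x = 0.
Proof. by rewrite -(scale0r (0 : HomQ q r)) compQZl scale0r. Qed.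
Lemma compQ0 p q r (y : HomQ q r) : compQ y (0 : HomQ p q) = 0.
Proof. by rewrite -(scale0r (0 : HomQ p q)) compQZr scale0r. Qed.

Definition Ind p p' (H : (p <= p')%VS) : HomQ p p' := cl (TInd H).
Definition Res p p' (H : (p <= p')%VS) : HomQ p' p := cl (TRes H).
Definition tau p p' : HomQ p p' := cl (TTau p p').

End Terms.

Section Invariants.
Variables (k : fieldType) (R : realType) (D : reductivePair R).
Local Notation P := (par D).
Local Notation HomQ := (@HomQ k R D).
Implicit Types (p q r : P).

Record objC := ObjC { objC_set :> {set P} ; objC_subproof : exists p, objC_set = worbit p }.

Lemma objC_eq (O O' : objC) : O = O' :> {set P} -> O = O'.
Proof.
case: O O' => [O HO] [O' HO'] /= e; subst O'.
by rewrite (Prop_irrelevance HO HO').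
Qed.

Definition orb p : objC := ObjC (ex_intro _ p erefl).

Lemma orb_wact (w : weyl D) p : orb (wact w p) = orb p.
Proof. exact/objC_eq/worbit_wact. Qed.

Lemma objC_wact (O : objC) (w : weyl D) p : (wact w p \in (O : {set P})) = (p \in (O : {set P})).
Proof. by case: (objC_subproof O) => q ->; apply: worbit_mem. Qed.

(* The W-invariant families indexed by O1 x O2, extended by 0 to all pairs.    *)
Record HomC (O1 O2 : objC) := MkHomC {
  fam :> forall p q, HomQ p q;
  fam_supp : forall p q, ~~ ((p \in (O1 : {set P})) && (q \in (O2 : {set P}))) ->
    fam p q = 0;
  fam_inv : forall (w : weyl D) p q, fam (wact w p) (wact w q) = actQ w (fam p q) }.

Lemma HomC_eq O1 O2 (x y : HomC O1 O2) : (forall p q, x p q = y p q) -> x = y.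
Proof.
case: x y => [x xs xi] [y ys yi] /= e.
have {}e : x = y by apply: functional_extensionality_dep => p;
  apply: functional_extensionality_dep => q.
by subst y; rewrite (Prop_irrelevance xs ys) (Prop_irrelevance xi yi).
Qed.

HB.instance Definition _ O1 O2 := gen_eqMixin (HomC O1 O2).
HB.instance Definition _ O1 O2 := gen_choiceMixin (HomC O1 O2).

Lemma actQ0 (w : weyl D) p q : actQ w (0 : HomQ p q) = 0.
Proof. by rewrite -(scale0r (0 : HomQ p q)) actQ_scale scale0r. Qed.

Lemma actQ_sum (w : weyl D) p q (J : finType) (F : J -> HomQ p q) (S : pred J) :
  actQ w (\sum_(j | S j) F j) = \sum_(j | S j) actQ w (F j).
Proof. by elim/big_rec2: _ => [|j x y _ <-]; rewrite ?actQ0 ?actQ_add. Qed.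

Definition suppC (O1 O2 : objC) (x : forall p q, HomQ p q) := forall p q,
  ~~ ((p \in (O1 : {set P})) && (q \in (O2 : {set P}))) -> x p q = 0.
Definition invC (x : forall p q, HomQ p q) := forall (w : weyl D) p q,
  x (wact w p) (wact w q) = actQ w (x p q).

Lemma addC_supp O1 O2 (x y : HomC O1 O2) : suppC O1 O2 (fun p q => x p q + y p q).
Proof. by move=> p q H; rewrite (fam_supp x H) (fam_supp y H) addr0. Qed.
Lemma addC_inv O1 O2 (x y : HomC O1 O2) : invC (fun p q => x p q + y p q).
Proof. by move=> w p q; rewrite !fam_inv actQ_add. Qed.
Definition addC O1 O2 (x y : HomC O1 O2) : HomC O1 O2 :=
  MkHomC (addC_supp x y) (addC_inv x y).

Lemma zeroC_supp O1 O2 : suppC O1 O2 (fun p q => 0). Proof. by []. Qed.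
Lemma zeroC_inv : invC (fun p q => 0).
Proof. by move=> w p q; rewrite actQ0. Qed.
Definition zeroC O1 O2 : HomC O1 O2 := MkHomC (@zeroC_supp O1 O2) zeroC_inv.

Lemma scaleC_supp O1 O2 c (x : HomC O1 O2) : suppC O1 O2 (fun p q => c *: x p q).
Proof. by move=> p q H; rewrite (fam_supp x H) scaler0. Qed.
Lemma scaleC_inv O1 O2 c (x : HomC O1 O2) : invC (fun p q => c *: x p q).
Proof. by move=> w p q; rewrite fam_inv actQ_scale. Qed.
Definition scaleC O1 O2 (c : k) (x : HomC O1 O2) : HomC O1 O2 :=
  MkHomC (scaleC_supp c x) (scaleC_inv c x).

Definition oppC O1 O2 (x : HomC O1 O2) : HomC O1 O2 := scaleC (-1) x.

Lemma addCA O1 O2 : associative (@addC O1 O2).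
Proof. by move=> x y z; apply: HomC_eq => p q; apply: addrA. Qed.
Lemma addCC O1 O2 : commutative (@addC O1 O2).
Proof. by move=> x y; apply: HomC_eq => p q; apply: addrC. Qed.
Lemma add0C O1 O2 : left_id (zeroC O1 O2) (@addC O1 O2).
Proof. by move=> x; apply: HomC_eq => p q; apply: add0r. Qed.
Lemma addNC O1 O2 : left_inverse (zeroC O1 O2) (@oppC O1 O2) (@addC O1 O2).
Proof. by move=> x; apply: HomC_eq => p q /=; rewrite scaleN1r addNr. Qed.
HB.instance Definition _ O1 O2 := GRing.isZmodule.Build (HomC O1 O2)
  (@addCA O1 O2) (@addCC O1 O2) (@add0C O1 O2) (@addNC O1 O2).

Section Composition.
Variables (O1 O2 O3 : objC) (b : HomC O2 O3) (a : HomC O1 O2).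

Definition comp_fam p1 p3 : HomQ p1 p3 :=
  \sum_(p2 in (O2 : {set P})) compQ (b p2 p3) (a p1 p2).

Lemma comp_supp : suppC O1 O3 comp_fam.
Proof.
move=> p1 p3 H; apply: big1 => p2 p2O.
move: H; rewrite negb_and => /orP[] H.
  by rewrite (fam_supp a) ?(negPf H) // compQ0.
by rewrite (fam_supp b) ?(negPf H) ?andbF // comp0Q.
Qed.

Lemma wact_inj (w : weyl D) : injective (@wact R D w).
Proof. by apply: (can_inj (g := wact w^-1%g)) => r; rewrite wactM mulgV wact1. Qed.

Lemma comp_inv : invC comp_fam.
Proof.
move=> w p1 p3; rewrite /comp_fam actQ_sum (reindex_inj (@wact_inj w)) /=.
apply: eq_big => [p2|p2 _]; first by rewrite objC_wact.
by rewrite actQ_comp !fam_inv.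
Qed.

Definition compC : HomC O1 O3 := MkHomC comp_supp comp_inv.

End Composition.

Definition single p q (a : HomQ p q) : forall p' q', HomQ p' q' := fun p' q' =>
  match pselect (p = p'), pselect (q = q') with
  | left e, left f => ecast x (HomQ x q') e (ecast y (HomQ p y) f a)
  | _, _ => 0
  end.

Lemma single_act (w : weyl D) p q (a : HomQ p q) p' q' :
  actQ w (single a p' q') = single (actQ w a) (wact w p') (wact w q').
Proof.
have wI := @wact_inj w.
rewrite /single; case: pselect => [e|ne]; last first.
  by rewrite actQ0; case: pselect => [/wI//|_].
case: pselect => [f|nf]; last first.
  by rewrite actQ0; case: pselect => // ?; case: pselect => [/wI//|_].
subst p' q' => /=; case: pselect => // e; case: pselect => // f.
by rewrite !eq_axiomK.
Qed.

Lemma single_actM (v w : weyl D) p q (a : HomQ p q) p' q' :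
  single (actQ w (actQ v a)) p' q' = single (actQ (v * w)%g a) p' q'.
Proof.
have [e f] := (wactM v w p, wactM v w q).
have castS p1 p2 q1 q2 (e1 : p1 = p2) (e2 : q1 = q2) (z : HomQ p1 q1) :
    single (ecast x (HomQ x q2) e1 (ecast y (HomQ p1 y) e2 z)) = single z.
  by subst p2 q2.
rewrite -(castS _ _ _ _ e f).
suff -> : ecast x (HomQ x (wact (v * w)%g q)) e
            (ecast y (HomQ (wact w (wact v p)) y) f (actQ w (actQ v a)))
          = actQ (v * w)%g a by [].
elim/HomQ_ind: a => a; rewrite !actQE -(tactM a e f).
by move: (tact w _); case: _ / e; case: _ / f.
Qed.

(* The average of a morphism of Q.                                             *)
Section Average.
Variables (p q : P) (a : HomQ p q).

Definition avg_fam p' q' : HomQ p' q' :=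
  (#|wstab p :&: wstab q|%:R : k)^-1 *: \sum_(w : weyl D) single (actQ w a) p' q'.

Lemma avg_supp : suppC (orb p) (orb q) avg_fam.
Proof.
move=> p' q' H; rewrite /avg_fam big1 ?scaler0 // => w _.
rewrite /single; case: pselect => // e; case: pselect => // f.
by case/negP: H; rewrite -e -f /= !worbit_mem !worbit_refl.
Qed.

Lemma avg_inv : invC avg_fam.
Proof.
move=> w p' q'; rewrite /avg_fam actQ_scale actQ_sum; congr (_ *: _).
rewrite (reindex_inj (mulIg w)) /=; apply: eq_bigr => v _.
by rewrite single_act single_actM.
Qed.

Definition avg : HomC (orb p) (orb q) := MkHomC avg_supp avg_inv.

End Average.

Definition castC (O1 O2 O2' : objC) (e : O2 = O2') (x : HomC O1 O2) : HomC O1 O2' :=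
  ecast X (HomC O1 X) e x.

Lemma castCE (O1 O2 O2' : objC) (e : O2 = O2') (x : HomC O1 O2) p q :
  castC e x p q = x p q.
Proof. by subst O2'. Qed.

(* W_i is the stabilizer of p_i; S contains exactly one representative of each *)
(* double coset W_1 w W_2.  The product of W is in the diagrammatic order, so  *)
(* that the composite a o w o b is (b * w * a)%g.                              *)
Definition double_coset_reps p1 p2 (S : {set weyl D}) :=
  forall v : weyl D, exists! w, w \in S /\
    exists a b, [/\ a \in wstab p1, b \in wstab p2 & v = (b * w * a)%g].

End Invariants.

(* Main.v *)
From HB Require Import structures.
Require Import Defs.
From mathcomp Require Import all_boot all_order all_algebra all_fingroup.
From mathcomp Require Import all_classical all_reals.
From mathcomp Require Import complex ring lra zify.
Set Implicit Arguments.
Unset Strict Implicit.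
Unset Printing Implicit Defensive.
Import Order.TTheory GRing.Theory Num.Theory.
Local Open Scope ring_scope.

(** Since Ind and Res are instances of tau, every morphism in the formula is an
average of some tau.  In characteristic 0 the average of tau(p, q) is the family
whose component at (p', q') is tau(p', q') when (p', q') lies in the W-orbit of
(p, q), and 0 otherwise ([avg_tau]).  Hence the left-hand side has the component
tau(p, q) at every pair in W p1 x W p2 ([comp_avg_top]), and the theorem amounts
to two facts about the term of w on the right-hand side: it has the component
tau(p, q) at the pairs in the orbit of (p1, w p2), and vanishes elsewhere
([comp_avg_tits]).  The double cosets W1 \ W / W2 label the orbits of W on
W p1 x W p2, so every pair meets exactly one term ([pair_orbit_reps]).

For the value of such a component, take a segment from a point a of the open cell
of p to a point c of the open cell of q.  Right after a it runs in the cell of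
p o q, and right before c in the cell of q o p; so the four cells of p, p o q,
q o p, q are met in this order, and two collinearity relations give
  tau(p, q) = tau(q o p, q) tau(p o q, q o p) tau(p, p o q)   ([tau_tits]).

The composite of three averages is a sum over chains p, r, s, q whose three
consecutive pairs lie in the orbits of (p1, p1 o q0), (p1 o q0, q0 o p1) and
(q0 o p1, q0), with q0 = w p2, but possibly by three different elements of W.  A
single element works, so that r = p o q and s = q o p are determined, because an
element of W which stabilizes a face fixes its linear span pointwise
([wact_span_fix]): p1 o q0 and q0 o p1 have the same span, and it contains the
cells of p1 and q0.

Two classical facts about the root system carry this out.  The first is that
parabolics are faces: the roots of p are the roots which are nonnegative at some
point ([par_face]), and conversely ([face_exists]).  The second is that an element
of W which preserves the signs of all roots at a point fixes the values of all
roots there ([weyl_fix]), because a W-orbit has at most one dominant point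
([dominant_unique]). *)

(** * Perturbation off finitely many hyperplanes *)

Section Generic.
Variables (R : realFieldType) (J : finType).

(** One step size serves all j: the bound is 1 / (1 + sum_j |w j| / |u j|), in which
the j with u j = 0 contribute 0 by the convention x / 0 = 0. *)
Lemma small_perturbation (u w : J -> R) : exists2 e : R, 0 < e &
  forall t, `|t| <= e -> forall j,
    (0 < u j -> 0 < u j + t * w j) /\ (u j < 0 -> u j + t * w j < 0).
Proof.
pose s := \sum_j `|w j| / `|u j|.
have s0 : 0 <= s by apply: sumr_ge0 => j _; rewrite divr_ge0.
have s1 : 0 < 1 + s by rewrite ltr_pwDl.
exists (1 + s)^-1; first by rewrite invr_gt0.
move=> t te j.
have H : u j != 0 -> `|t * w j| < `|u j|.
  move=> uj; have uj0 : 0 < `|u j| by rewrite normr_gt0.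
  apply: (@le_lt_trans _ _ ((1 + s)^-1 * `|w j|)).
    by rewrite normrM ler_wpM2r.
  rewrite mulrC ltr_pdivrMr // -ltr_pdivrMl // mulrC.
  apply: (@le_lt_trans _ _ s); last by rewrite ltrDr.
  by rewrite /s (bigD1 j) //= lerDl sumr_ge0 // => l _; rewrite divr_ge0.
split=> uj.
  move: (H (lt0r_neq0 uj)); rewrite (gtr0_norm uj) ltr_norml => /andP[]; lra.
move: (H (ltr0_neq0 uj)); rewrite (ltr0_norm uj) ltr_norml => /andP[]; lra.
Qed.

(** The complement of finitely many hyperplanes is dense: treat the functionals one
at a time, moving a little in a direction that the current one does not kill.
Regular points, points of a chamber in general position with respect to a ray, and
generic points of a wall are all obtained from this lemma. *)
Lemma generic_perturbation (V : lmodType R) (f : J -> V -> R)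
    (f_lin : forall j a x y, f j (a *: x + y) = a * f j x + f j y) (x0 : V) :
  exists x, forall j, (0 < f j x0 -> 0 < f j x) /\ (f j x = 0 -> forall v, f j v = 0).
Proof.
suff H (s : seq J) : exists x, (forall j, 0 < f j x0 -> 0 < f j x) /\
    forall j, j \in s -> f j x = 0 -> forall v, f j v = 0.
  have [x [xp xz]] := H (enum J); exists x => j; split; first exact: xp.
  by apply: xz; rewrite mem_enum.
elim: s => [|l s [x [xp xz]]]; first by exists x0.
have [[v lv]|no] := pselect (exists v, f l v <> 0); last first.
  exists x; split=> // j; rewrite inE => /predU1P[-> _ v|]; last exact: xz.
  by apply: contrapT => lv; apply: no; exists v.
have [lx|lx] := eqVneq (f l x) 0; last first.
  exists x; split=> // j; rewrite inE => /predU1P[-> l0|]; last exact: xz.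
  by move/eqP: lx.
have [e e0 He] := small_perturbation (f^~ x) (f^~ v).
have {}He := He e _; rewrite gtr0_norm // in He; have {}He := He (lexx e).
exists (e *: v + x); split=> [j /xp jx|j].
  by rewrite f_lin addrC; apply: (proj1 (He j)).
rewrite inE => /predU1P[->|js]; rewrite f_lin.
  by rewrite lx addr0 => /eqP; rewrite mulf_eq0 (gt_eqF e0) /= => /eqP /lv.
have [/(xz j js) jx _|] := eqVneq (f j x) 0; first exact: jx.
have [jp jn] := He j; rewrite addrC neq_lt => /orP[/jn|/jp] /[swap] ->; by rewrite ltxx.
Qed.

End Generic.

(** * Reflections of roots and coroots *)

Section RootData.
Local Open Scope complex_scope.
Variables (R : realType) (D : reductivePair R).
Local Notation I := (rootI D).
Local Notation V := (hR D).
Local Notation root := (@Defs.root R D).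
Implicit Types (i j l : I) (x y v : V).

Lemma rootRD i x y : rootR i (x + y) = rootR i x + rootR i y.
Proof. by rewrite -[x]scale1r rootR_linear mul1r scale1r. Qed.
Lemma rootR0 i : rootR i 0 = 0.
Proof. by apply: (addrI (rootR i 0)); rewrite -rootRD !addr0. Qed.
Lemma rootRZ i a x : rootR i (a *: x) = a * rootR i x.
Proof. by rewrite -[a *: x]addr0 rootR_linear rootR0 addr0. Qed.
Lemma rootRN i x : rootR i (- x) = - rootR i x.
Proof. by rewrite -scaleN1r rootRZ mulN1r. Qed.
Lemma rootRB i x y : rootR i (x - y) = rootR i x - rootR i y.
Proof. by rewrite rootRD rootRN. Qed.
Lemma rootR_sum i (J : finType) (P : pred J) (F : J -> V) :
  rootR i (\sum_(j | P j) F j) = \sum_(j | P j) rootR i (F j).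
Proof. by elim/big_rec2: _ => [|j x y _ <-]; rewrite ?rootR0 ?rootRD. Qed.

(** The span of the real form over the complex numbers is the whole Cartan subalgebra. *)
Lemma cartan_form_ext (a b : 'Hom(subvs_of (cartan D), R[i]^o)) :
  (forall x : V, a (hR_incl x) = b (hR_incl x)) -> a = b.
Proof.
move=> ab; apply/lfunP => z; have [[x y] [/= -> _]] := hR_real_form z.
by rewrite !linearD !linearZ /= !ab.
Qed.

Lemma rootR_inj i j : (forall x, rootR i x = rootR j x) -> i = j.
Proof.
by move=> e; apply/root_inj/cartan_form_ext => x; rewrite !rootRE e.
Qed.

Lemma rootR_sumP i j l : (forall x, rootR l x = rootR i x + rootR j x) ->
  root l = root i + root j.
Proof.
move=> e; apply: cartan_form_ext => x.
by rewrite add_lfunE !rootRE e rmorphD.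
Qed.

Lemma root_neq0 i : root i <> 0.
Proof. by have [+ _] := Defs.rootP (root i) => /(_ (ex_intro _ i erefl))[]. Qed.

(** The lift of the reflection to an automorphism of the Lie algebra maps the root
space of j to a nonzero weight space, whose weight is the reflected root. *)
Lemma reflected_root i j :
  exists l, forall x, rootR l x = rootR j x - rootR j (coroot i) * rootR i x.
Proof.
have [t [t0 tL ty]] := refl_lift i.
pose c : R[i] := root j (hR_incl (coroot i)).
pose a : 'Hom(subvs_of (cartan D), R[i]^o) := root j - c *: root i.
have aE z : a z = (root j z : R[i]) - c * root i z.
  by rewrite /a add_lfunE opp_lfunE scale_lfunE.
have [l la] : exists l, root l = a.
  apply/Defs.rootP; split.
    move=> a0; have c0 : c = 0.
      have := aE (hR_incl (coroot i)); rewrite a0 root_coroot lfunE /= -/c => /eqP.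
      by rewrite mulr_natr mulr2n opprD addrA subrr add0r eq_sym oppr_eq0 => /eqP.
    by apply: (@root_neq0 j); rewrite -a0 /a c0 scale0r subr0.
  have [x xj x0] : exists2 x, x \in root_space j & x != 0.
    exists (vpick (root_space j)); first exact: memv_pick.
    by rewrite vpick0 -dimv_eq0 dim_rspace.
  move=> w0; have : t x \in weight_space a.
    apply/weight_spaceP => y.
    pose z := y - (root i y : R[i]) *: hR_incl (coroot i).
    have zy : t (vsval z) = vsval y.
      rewrite ty; congr vsval.
      have -> : (root i z : R[i]) = - (root i y : R[i]).
        rewrite /z linearB linearZ /= root_coroot.
        change (root i y - (root i y : R[i]) * 2 = - root i y :> R[i]).
        by rewrite mulr_natr mulr2n opprD addrA subrr add0r.
      by rewrite scaleNr opprK /z subrK.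
    rewrite -zy -tL (weight_spaceP _ _ xj) linearZ /=; congr (_ *: _).
    rewrite aE /z linearB linearZ /=.
    by congr (_ - _); apply: mulrC.
  rewrite w0 memv0 => /eqP tx0; case/negP: x0; apply/eqP.
  have /lker0P := introT eqP t0; apply.
  by rewrite tx0 linear0.
exists l => x; apply: complexI; rewrite -rootRE la aE rmorphB rmorphM /=.
by rewrite /c !rootRE.
Qed.

Definition root_refl i j : I := projT1 (cid (reflected_root i j)).

Lemma rootR_root_refl i j x :
  rootR (root_refl i j) x = rootR j x - rootR j (coroot i) * rootR i x.
Proof. by rewrite /root_refl; case: cid. Qed.

Definition vec_refl i x : V := x - rootR i x *: coroot i.

Lemma rootR_vec_refl i j x : rootR j (vec_refl i x) = rootR (root_refl i j) x.
Proof. by rewrite rootR_root_refl rootRB rootRZ mulrC. Qed.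

Lemma root_refl_coroot i j : rootR (root_refl i j) (coroot i) = - rootR j (coroot i).
Proof. rewrite rootR_root_refl rootR_coroot; ring. Qed.

Lemma root_reflK i : involutive (root_refl i).
Proof.
move=> j; apply: rootR_inj => x; rewrite rootR_root_refl root_refl_coroot rootR_root_refl.
ring.
Qed.

Lemma rootR_refl_refl i j x : rootR (root_refl i j) (vec_refl i x) = rootR j x.
Proof. by rewrite rootR_vec_refl root_reflK. Qed.

Definition oppi i := root_refl i i.

Lemma rootR_oppi i x : rootR (oppi i) x = - rootR i x.
Proof. rewrite rootR_root_refl rootR_coroot; ring. Qed.

Lemma oppiK : involutive oppi.
Proof. by move=> i; apply: rootR_inj => x; rewrite !rootR_oppi opprK. Qed.

(** The Weyl-invariant form; its radical is the common kernel of the roots, which is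
the central part of hR, so that it is definite only modulo that kernel. *)
Definition qform x y := \sum_i rootR i x * rootR i y.

Lemma qformC x y : qform x y = qform y x.
Proof. by apply: eq_bigr => i _; rewrite mulrC. Qed.

Lemma qform_vec_refl i x y : qform (vec_refl i x) (vec_refl i y) = qform x y.
Proof.
rewrite /qform (reindex_inj (can_inj (root_reflK i))).
by apply: eq_bigr => j _; rewrite !rootR_refl_refl.
Qed.

Lemma qform_linear a x y v : qform (a *: x + y) v = a * qform x v + qform y v.
Proof.
rewrite /qform mulr_sumr -big_split; apply: eq_bigr => i _ /=.
rewrite rootR_linear; ring.
Qed.

Lemma qform0 v : qform 0 v = 0.
Proof. by rewrite /qform big1 // => i _; rewrite rootR0 mul0r. Qed.

Lemma qform_eq0 x : qform x x <= 0 -> forall i, rootR i x = 0.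
Proof.
move=> q0 i; apply/eqP; rewrite -sqrf_eq0 eq_le sqr_ge0 andbT.
apply: le_trans q0; rewrite /qform (bigD1 i) //= -expr2 lerDl sumr_ge0 // => j _.
by rewrite -expr2 sqr_ge0.
Qed.

Definition coroot_norm i := qform (coroot i) (coroot i).

Lemma coroot_norm_gt0 i : 0 < coroot_norm i.
Proof.
rewrite ltNge; apply/negP => /qform_eq0/(_ i); rewrite rootR_coroot => /eqP.
by rewrite pnatr_eq0.
Qed.

(** The reflection in i preserves the form and negates the coroot of i; so the coroot
is, up to a scalar, the vector that represents the root i. *)
Lemma qform_coroot i x : 2 * qform x (coroot i) = coroot_norm i * rootR i x.
Proof.
have := qform_vec_refl i x (coroot i).
have -> : vec_refl i (coroot i) = (-1) *: coroot i + 0.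
  rewrite /vec_refl rootR_coroot addr0 scaleN1r scaler_nat mulr2n.
  by rewrite opprD addrA subrr add0r.
rewrite qformC qform_linear qform0 addr0 /vec_refl addrC -scaleNr.
rewrite [qform (coroot i) _]qformC qform_linear -/(coroot_norm i); lra.
Qed.

(** Both sides are twice the form at the coroots of i and j. *)
Lemma coroot_sym i j : rootR i (coroot j) * coroot_norm i = rootR j (coroot i) * coroot_norm j.
Proof.
have := qform_coroot i (coroot j); have := qform_coroot j (coroot i).
by rewrite qformC => -> e; rewrite mulrC -e mulrC.
Qed.

End RootData.

(** * Closed sets of roots *)

Section ClosedSets.
Variables (R : realType) (D : reductivePair R).
Local Notation I := (rootI D).
Local Notation V := (hR D).
Implicit Types (i j l : I) (x y v : V).

Lemma coroot_int i j : exists n : int, rootR j (coroot i) = n%:~R.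
Proof.
have [n e] := root_int i j; exists n; rewrite /rootR e.
by apply: complexI; rewrite RRe_real ?realz // rmorph_int.
Qed.

(** Both Cartan integers are negative.  If one is -1, a reflection yields the sum.  If
both are at most -2, the vector u which represents half the sum of the two roots
has norm at most 0, so the roots are opposite. *)
Lemma root_add i j : rootR i (coroot j) < 0 -> j <> oppi i ->
  exists l, forall x, rootR l x = rootR i x + rootR j x.
Proof.
move=> ij0 nij; have ni := coroot_norm_gt0 i; have nj := coroot_norm_gt0 j.
have sij := coroot_sym i j.
have ji0 : rootR j (coroot i) < 0.
  by rewrite -(pmulr_llt0 _ nj) -sij pmulr_llt0.
have [a ae] := coroot_int j i; have [b be] := coroot_int i j.
have [aE|a1] := eqVneq a (-1).
  by exists (root_refl j i) => x; rewrite rootR_root_refl ae aE; ring.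
have [bE|b1] := eqVneq b (-1).
  by exists (root_refl i j) => x; rewrite rootR_root_refl be bE; ring.
have a2 : rootR i (coroot j) <= -2.
  by move: ij0; rewrite ae ltrz0 -[-2]/((-2)%:~R) ler_int; lia.
have b2 : rootR j (coroot i) <= -2.
  by move: ji0; rewrite be ltrz0 -[-2]/((-2)%:~R) ler_int; lia.
pose u : V := (coroot_norm i)^-1 *: coroot i + (coroot_norm j)^-1 *: coroot j.
have qu x : 2 * qform x u = rootR i x + rootR j x.
  rewrite qformC qform_linear -[_ *: coroot j]addr0 qform_linear qform0 addr0.
  rewrite ![qform (coroot _) x]qformC.
  have -> : qform x (coroot i) = coroot_norm i * rootR i x / 2 by rewrite -qform_coroot; field.
  have -> : qform x (coroot j) = coroot_norm j * rootR j x / 2 by rewrite -qform_coroot; field.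
  by field; rewrite !gt_eqF.
have ui : rootR i u + rootR j u <= 0.
  rewrite !rootRD !rootRZ !rootR_coroot.
  have := ler_wpM2l (ltW (_ : 0 < (coroot_norm j)^-1)) a2; rewrite invr_gt0 => /(_ nj).
  have := ler_wpM2l (ltW (_ : 0 < (coroot_norm i)^-1)) b2; rewrite invr_gt0 => /(_ ni).
  lra.
case: nij; apply: rootR_inj => x; rewrite rootR_oppi; apply/eqP.
rewrite -addr_eq0 addrC -qu.
have /qform_eq0 u0 : qform u u <= 0 by move: (qu u); lra.
by rewrite qformC /qform big1 ?mulr0 // => l _; rewrite u0 mul0r.
Qed.

(** The form determines coroots from roots, so proportional roots have inversely
proportional coroots. *)
Lemma coroot_proportional i j c : (forall x, rootR j x = c * rootR i x) ->
  forall l, rootR l (coroot j) * c = rootR l (coroot i).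
Proof.
move=> e l; have ni := coroot_norm_gt0 i; have nl := coroot_norm_gt0 l.
have H m : rootR m (coroot j) * coroot_norm i = c * rootR m (coroot i) * coroot_norm j.
  have nm := coroot_norm_gt0 m; apply: (mulIf (negbT (gt_eqF nm))).
  have := coroot_sym m j; have := coroot_sym m i; rewrite e => e1 e2.
  transitivity (rootR m (coroot j) * coroot_norm m * coroot_norm i); first by ring.
  rewrite e2; transitivity (c * (rootR i (coroot m) * coroot_norm i) * coroot_norm j).
    by ring.
  rewrite -e1; ring.
have := H j; rewrite rootR_coroot e rootR_coroot => e1.
have c0 : c != 0.
  by apply/eqP => c0; move: e1; rewrite c0; move: ni; lra.
apply: (mulIf c0); apply: (mulIf (negbT (gt_eqF (coroot_norm_gt0 j)))).
rewrite -[rootR l (coroot i) * c]mulrC -H.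
have -> : coroot_norm i = c * c * coroot_norm j by lra.
ring.
Qed.

Lemma root_refl_proportional i j c : (forall x, rootR j x = c * rootR i x) ->
  root_refl j =1 root_refl i.
Proof.
move=> e l; apply: rootR_inj => x; rewrite !rootR_root_refl e.
by rewrite -(coroot_proportional e) mulrA.
Qed.

Definition root_closed (S : {set I}) := forall i j l, i \in S -> j \in S ->
  (forall x, rootR l x = rootR i x + rootR j x) -> l \in S.

Section Closed.
Variable (S : {set I}).
Hypothesis closedS : root_closed S.

(** The root string from j towards its reflection stays in S: when n is the negative
Cartan integer, j + i has Cartan integer n + 2, so by induction S contains its
reflection, to which one more i is added. *)
Lemma closed_root_refl i j : i \in S -> j \in S -> rootR j (coroot i) <= 0 ->
  root_refl i j \in S.
Proof.
move=> iS jS ij0; have [n ne] := coroot_int i j.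
have {ij0} : rootR j (coroot i) = - (`|n|%N)%:R.
  move: ij0; rewrite ne lerz0 => n0.
  by rewrite {1}(_ : n = - (`|n|%N)%:Z) ?rmorphN //; lia.
move: {n ne} (`|n|%N) => m; elim/ltn_ind: m j jS => -[|[|m]] IH j jS ij.
- suff -> : root_refl i j = j by [].
  by apply: rootR_inj => x; rewrite rootR_root_refl ij; ring.
- have [->|nij] := pselect (j = oppi i); first by rewrite -/(oppi i) root_reflK.
  have [l le] : exists l, forall x, rootR l x = rootR j x + rootR i x.
    by apply: root_add; [rewrite ij; lra | move=> e; apply: nij; rewrite e oppiK].
  suff -> : root_refl i j = l by apply: closedS le.
  by apply: rootR_inj => x; rewrite rootR_root_refl ij le; ring.
have [->|nij] := pselect (j = oppi i); first by rewrite -/(oppi i) root_reflK.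
have [l le] : exists l, forall x, rootR l x = rootR j x + rootR i x.
  apply: root_add; last by move=> e; apply: nij; rewrite e oppiK.
  by rewrite ij oppr_lt0 ltr0n.
have li : rootR l (coroot i) = - m%:R by rewrite le ij rootR_coroot -[m.+2]addn2 natrD; ring.
have slS : root_refl i l \in S by apply: (IH m) => //; apply: closedS le.
apply: (closedS slS iS) => x; rewrite !rootR_root_refl ij li le -[m.+2]addn2 natrD.
ring.
Qed.

Lemma closed_root_refl_levi i j : i \in S -> oppi i \in S -> j \in S -> root_refl i j \in S.
Proof.
move=> iS niS jS; have [ij|ij] := leP (rootR j (coroot i)) 0; first exact: closed_root_refl.
have e x : rootR (oppi i) x = (-1) * rootR i x by rewrite rootR_oppi mulN1r.
rewrite -(root_refl_proportional e); apply: closed_root_refl => //.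
by have := coroot_proportional e j; lra.
Qed.

Let N := [set i in S | oppi i \notin S].

(** N, the set of roots of the nilradical, is stable under the reflections of the Levi
subsystem, and under those which, for a root i of S, move a root of N in the
positive direction of i. *)
Lemma closed_root_refl_nil i j : i \in S -> j \in N ->
  (oppi i \in S) || (rootR j (coroot i) <= 0) ->
  root_refl i j \in N.
Proof.
rewrite !inE => iS /andP[jS njS] H.
have e : oppi (root_refl i j) = root_refl i (oppi j).
  by apply: rootR_inj => x; rewrite !(rootR_oppi, rootR_root_refl); ring.
have sS : root_refl i j \in S.
  by case/orP: H => H; [apply: closed_root_refl_levi | apply: closed_root_refl].
rewrite sS /=; apply: contra njS => nsS; rewrite -(root_reflK i (oppi j)) -e.
case/orP: H => H; first exact: closed_root_refl_levi.
by apply: closed_root_refl => //; rewrite rootR_oppi root_refl_coroot; lra.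
Qed.

(** The vector y represents half the sum of N.  For i in the Levi subsystem the reflection
in i permutes N and negates the Cartan integers with i, so i vanishes at y.  For i
in N it maps the j in N with negative Cartan integer injectively to some with the
opposite positive one, and i itself is not attained; what is left of the sum of the
Cartan integers is at least the contribution 2 of i. *)
Lemma closed_face : (forall i, (i \in S) || (oppi i \in S)) ->
  exists y, S = [set i | 0 <= rootR i y].
Proof.
move=> total; pose y : V := \sum_(j in N) (coroot_norm j)^-1 *: coroot j.
have yE i : rootR i y * coroot_norm i = \sum_(j in N) rootR j (coroot i).
  rewrite rootR_sum mulr_suml; apply: eq_bigr => j _.
  rewrite rootRZ -mulrA coroot_sym mulrC -mulrA divff ?mulr1 //.
  by rewrite gt_eqF ?coroot_norm_gt0.
have sgn i : rootR i y * coroot_norm i = 0 -> rootR i y = 0.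
  by move/eqP; rewrite mulf_eq0 [coroot_norm i == 0]gt_eqF ?coroot_norm_gt0 // orbF => /eqP.
have yL i : i \in S -> oppi i \in S -> rootR i y = 0.
  move=> iS niS; apply: sgn; rewrite yE.
  have : \sum_(j in N) rootR j (coroot i) = - \sum_(j in N) rootR j (coroot i).
    rewrite {1}(reindex_inj (can_inj (root_reflK i))) -sumrN /=.
    apply: eq_big => [j|j _]; last exact: root_refl_coroot.
    apply/idP/idP => jN; last by apply: closed_root_refl_nil; rewrite ?niS.
    by rewrite -(root_reflK i j) closed_root_refl_nil ?niS.
  lra.
have yN i : i \in N -> 0 < rootR i y.
  move=> iN; have iS : i \in S by move: iN; rewrite inE => /andP[].
  rewrite -(pmulr_lgt0 _ (coroot_norm_gt0 i)) yE.
  rewrite (bigID (fun j => rootR j (coroot i) < 0)) /=.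
  rewrite (reindex_inj (can_inj (root_reflK i))) /=.
  under eq_bigr do rewrite root_refl_coroot.
  rewrite sumrN addrC subr_gt0 [ltRHS](bigD1 i) /=; last first.
    by rewrite iN rootR_coroot -leNgt ler0n.
  rewrite rootR_coroot.
  apply: (@le_lt_trans _ _ (\sum_(j | (j \in N) && ~~ (rootR j (coroot i) < 0) &&
    (j != i)) rootR j (coroot i))); last by rewrite ltrDr.
  rewrite [leLHS]big_mkcond [leRHS]big_mkcond /=; apply: ler_sum => j _.
  have [/andP[sjN]|_] := ifP; last by case: ifP => // /andP[/andP[_]]; rewrite -leNgt.
  rewrite root_refl_coroot oppr_lt0 => ij; rewrite ifT // -leNgt (ltW ij) andbT.
  rewrite -{1}(root_reflK i j) (closed_root_refl_nil iS sjN)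
    ?root_refl_coroot ?oppr_le0 ?(ltW ij) ?orbT //=.
  apply/eqP => jE; move: sjN; rewrite jE -/(oppi i) inE oppiK iS /=.
  by rewrite andbF.
exists y; apply/setP => i; rewrite inE.
have [iS|niS] := boolP (i \in S).
  have [nS|nS] := boolP (oppi i \in S); first by rewrite yL ?lexx.
  by rewrite ltW // yN // inE iS.
apply/esym/negbTE; rewrite -ltNge -oppr_gt0 -rootR_oppi; apply: yN.
by rewrite inE oppiK niS andbT; have := total i; rewrite (negPf niS).
Qed.

End Closed.
End ClosedSets.

(** * Parabolic subalgebras and faces *)

Section Faces.
Local Open Scope complex_scope.
Variables (R : realType) (D : reductivePair R).
Local Notation I := (rootI D).
Local Notation V := (hR D).
Local Notation root := (@Defs.root R D).
Implicit Types (i j l : I) (x y v : V) (p q r : par D).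

(** Its adjoint action tells the root spaces and the Cartan subalgebra apart. *)
Lemma separating_vector : exists z : V, forall i,
  rootR i z <> 0 /\ forall j, i <> j -> rootR i z <> rootR j z.
Proof.
pose f (k : I * option I) (x : V) :=
  rootR k.1 x - (if k.2 is Some j then rootR j x else 0).
have [|z Hz] := @generic_perturbation R _ V f _ 0.
  by move=> [i [j|]] a x y; rewrite /f /= !rootR_linear; ring.
exists z => i; split=> [iz|j ij e].
  have := (Hz (i, None)).2; rewrite /f /= iz subr0 => /(_ erefl (coroot i)).
  by rewrite rootR_coroot subr0 => /eqP; rewrite pnatr_eq0.
apply: ij; apply: rootR_inj => x.
by have := (Hz (i, Some j)).2; rewrite /f /= e subrr
  => /(_ erefl x)/eqP; rewrite subr_eq0 => /eqP.
Qed.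

(** Eigenvectors for distinct eigenvalues of the adjoint action of a separating vector:
subtracting one eigenvalue removes one summand and scales u by a nonzero factor. *)
Lemma root_space_indep (J : {set I}) i (u : D) : i \notin J ->
  u \in root_space i -> u \in subspace_of J -> u = 0.
Proof.
move=> iJ ui /memv_addP[h hh [w /memv_sumP[g gJ ->] uE]].
have [z Hz] := separating_vector.
have adh (h' : D) : h' \in cartan D -> ad D (vsval (hR_incl z)) h' = 0.
  rewrite -{1}cartan_centralizer => /weight_spaceP/(_ (hR_incl z)) ->.
  by rewrite lfunE /= scale0r.
have adg l (g' : D) : g' \in root_space l ->
    ad D (vsval (hR_incl z)) g' = (rootR l z)%:C *: g'.
  by move=> /weight_spaceP/(_ (hR_incl z)) ->; rewrite rootRE.
have H (s : seq I) : i \notin s -> forall (u' h' : D) (g' : I -> D), u' \in root_space i ->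
    h' \in cartan D -> (forall l, g' l \in root_space l) ->
    u' = h' + \sum_(l <- s) g' l -> u' = 0.
  elim: s => [_|j s IH] /=.
    move=> u' h' g' u'i h'h _; rewrite big_nil addr0 => e.
    have := adg _ _ u'i; rewrite {1}e adh // => /esym/eqP; rewrite scaler_eq0.
    by case/orP=> /eqP // /complexI e0; case: (proj1 (Hz i)).
  rewrite inE => /norP[/eqP ij is_] u' h' g' u'i h'h g'l; rewrite big_cons => e.
  pose c l := (rootR l z - rootR j z)%:C.
  have : c i *: u' = 0.
    apply: (IH is_ _ (- (rootR j z)%:C *: h') (fun l => c l *: g' l)).
    - exact: memvZ.
    - exact: memvZ.
    - by move=> l; apply: memvZ.
    have -> : c i *: u' = ad D (vsval (hR_incl z)) u' - (rootR j z)%:C *: u'.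
      by rewrite (adg _ _ u'i) -scalerBl /c rmorphB.
    rewrite e; set g's := \sum_(l <- s) g' l.
    have -> : ad D (vsval (hR_incl z)) (h' + (g' j + g's)) =
        (rootR j z)%:C *: g' j + \sum_(l <- s) (rootR l z)%:C *: g' l.
      rewrite !linearD linear_sum /= adh // add0r (adg _ _ (g'l j)).
      by congr (_ + _); apply: eq_bigr => l _; apply: adg.
    have -> : \sum_(l <- s) c l *: g' l =
        \sum_(l <- s) (rootR l z)%:C *: g' l - (rootR j z)%:C *: g's.
      rewrite scaler_sumr -sumrB; apply: eq_bigr => l _.
      by rewrite -scalerBl /c rmorphB.
    rewrite [_ *: (h' + _)]scalerDr [_ *: (g' j + _)]scalerDr.
    by rewrite opprD addrCA scaleNr opprD addrACA subrr add0r.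
  move/eqP; rewrite scaler_eq0 => /orP[|/eqP //]; rewrite /c => /eqP/complexI/eqP.
  by rewrite subr_eq0 => /eqP/(proj2 (Hz i) _ ij).
pose g' l := if l \in J then g l else 0.
apply: (H (enum J) _ u h g') => //.
- by rewrite mem_enum.
- by move=> l; rewrite /g'; case: ifP => lJ; [exact: gJ | exact: mem0v].
rewrite uE big_enum /=; congr (_ + _); apply: eq_bigr => l lJ.
by rewrite /g' lJ.
Qed.

Lemma root_space_subE (J : {set I}) i : (root_space i <= subspace_of J)%VS = (i \in J).
Proof.
apply/idP/idP => [iJ|iJ]; last first.
  by apply: subv_trans (addvSr _ _); apply: (sumv_sup i).
apply: contraT => /root_space_indep H.
have := memv_pick (root_space i) => xi.
have /eqP := H _ xi (subvP iJ _ xi).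
by rewrite vpick0 -dimv_eq0 dim_rspace.
Qed.

Lemma roots_of_subspace (J : {set I}) : roots_of (subspace_of J) = J.
Proof. by apply/setP => i; rewrite inE root_space_subE. Qed.

Lemma root_bracket i j (x y : D) : x \in root_space i -> y \in root_space j ->
  ad D x y \in weight_space (root i + root j).
Proof.
move=> xi yj; apply/weight_spaceP => h.
rewrite ad_jacobi (weight_spaceP _ _ xi) (weight_spaceP _ _ yj).
by rewrite linearZ /= scale_lfunE linearZ /= add_lfunE scalerDl.
Qed.

Lemma roots_of_closed p : root_closed (roots_of p).
Proof.
move=> i j l; rewrite !inE => ip jp e.
have le := rootR_sumP e; have [x [y [xi yj xy0]]] := ad_root_space le.
have [pL _] := parP p.
have xyl : ad D x y \in root_space l by rewrite /root_space le; apply: root_bracket.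
rewrite (root_space_line xyl); last exact/eqP.
by rewrite -memvE; apply: pL; [apply: (subvP ip)|apply: (subvP jp)].
Qed.

(** y lies in the relative interior of the cell of p, see [relint_cellP]; this form
makes incidence of faces a matter of signs of roots. *)
Definition isface y p := roots_of p = [set i | 0 <= rootR i y].

Lemma par_face p : exists y, isface y p.
Proof.
apply: closed_face (@roots_of_closed p) _ => i.
have [_ [x xr xp]] := parP p.
have H j : 0 < rootR j x -> j \in roots_of p.
  move=> jx; rewrite inE; apply: subv_trans xp; apply: subv_trans (addvSr _ _).
  exact: (sumv_sup j).
have [ix|ix] := ltP 0 (rootR i x); first by rewrite H.
apply/orP; right; apply: H; rewrite rootR_oppi oppr_gt0 lt_neqAle ix andbT.
exact/eqP/xr.
Qed.

Lemma ad_skew (x y : D) : ad D x y = - ad D y x.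
Proof.
have e : ad D (x + y) = ad D x + ad D y by rewrite linearD.
have := ad_alt (x + y); rewrite e add_lfunE !linearD /= !ad_alt.
by rewrite add0r addr0 => /eqP; rewrite addr_eq0 => /eqP.
Qed.

(** Nonnegativity at y is additive, so the roots involved form a closed set; and they
include the positive roots of a regular point near y. *)
Lemma face_is_par y : is_par (subspace_of [set i : I | 0 <= rootR i y]).
Proof.
set J := [set i | _]; split; last first.
  have [|x Hx] := @generic_perturbation R _ V (@rootR R D) _ y.
    by move=> *; rewrite rootR_linear.
  exists x => [i ix|].
    have := (Hx i).2 ix (coroot i); rewrite rootR_coroot => /eqP.
    by rewrite pnatr_eq0.
  rewrite addvS //; apply/subv_sumP => i ix; apply: (sumv_sup i) => //.
  rewrite inE leNgt -oppr_gt0 -rootR_oppi; apply/negP => /(Hx _).1.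
  by rewrite rootR_oppi oppr_gt0 ltNge (ltW ix).
have hJ (h u : D) : h \in cartan D -> u \in subspace_of J -> ad D h u \in subspace_of J.
  move=> hh /memv_addP[h' hh' [w /memv_sumP[g gJ ->] ->]].
  rewrite linearD linear_sum /= -(vsprojK hh).
  have -> : ad D (vsval (vsproj (cartan D) h)) h' = 0.
    move: hh'; rewrite -{1}cartan_centralizer => /weight_spaceP ->.
    by rewrite lfunE /= scale0r.
  rewrite add0r; apply: (subvP (addvSr _ _)); apply: memv_sumr => i iJ.
  by rewrite (weight_spaceP _ _ (gJ i iJ)) memvZ // gJ.
move=> u u' /memv_addP[h hh [w /memv_sumP[g gJ ->] ->]] u'J.
have -> : ad D (h + \sum_(i in J) g i) = ad D h + \sum_(i in J) ad D (g i).
  by rewrite linearD linear_sum.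
rewrite add_lfunE sum_lfunE memvD ?hJ //.
apply: memv_suml => i iJ.
case/memv_addP: u'J => h' hh' [w' /memv_sumP[g' gJ' ->] ->].
have gJs j : j \in J -> (root_space j <= subspace_of J)%VS.
  by move=> jJ; rewrite root_space_subE.
rewrite linearD linear_sum /= memvD //.
  by rewrite ad_skew memvN hJ // (subvP (gJs i iJ)) // gJ.
apply: memv_suml => j jJ.
have := root_bracket (gJ i iJ) (gJ' j jJ); set a := _ + _ => aw.
have [->|x0] := eqVneq (ad D (g i) (g' j)) 0; first exact: mem0v.
have [a0|a0] := pselect (a = 0).
  apply: (subvP (addvSl _ _)); rewrite -cartan_centralizer -a0; exact: aw.
have [l la] : exists l, root l = a.
  apply/Defs.rootP; split=> // w0; move: aw; rewrite w0 memv0.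
  by rewrite (negPf x0).
have lJ : l \in J.
  have e : rootR l y = rootR i y + rootR j y.
    by apply: complexI; rewrite -rootRE la add_lfunE !rootRE rmorphD.
  by move: iJ jJ; rewrite !inE e; apply: addr_ge0.
by apply: (subvP (gJs l lJ)); rewrite /root_space la.
Qed.

Lemma face_exists y : exists p, isface y p.
Proof.
exists (Par (asboolT (face_is_par y))).
by rewrite /isface /= roots_of_subspace.
Qed.

Lemma isface_unique y p q : isface y p -> isface y q -> p = q.
Proof. by move=> yp yq; apply: par_eq; rewrite yp yq. Qed.

Lemma par_sub p q : roots_of p \subset roots_of q -> (p <= q)%VS.
Proof.
move=> /fintype.subsetP s; rewrite -(par_weights (parP p)) -(par_weights (parP q)).
rewrite addvS //; apply/subv_sumP => i ip; apply: (sumv_sup i) => //; exact: s.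
Qed.

Lemma isface_gt0 y p i : isface y p -> (oppi i \notin roots_of p) = (0 < rootR i y).
Proof. by move->; rewrite inE rootR_oppi oppr_ge0 ltNge. Qed.

Lemma isface_ge0 y p i : isface y p -> (i \in roots_of p) = (0 <= rootR i y).
Proof. by move->; rewrite inE. Qed.

Lemma isface_eq0 y p i : isface y p ->
  (i \in roots_of p) && (oppi i \in roots_of p) = (rootR i y == 0).
Proof.
by move->; rewrite !inE rootR_oppi oppr_ge0 eq_le andbC.
Qed.

(** y can be moved a little within the cell in every direction on which the roots
vanishing at y vanish. *)
Lemma linspan_cell y p : isface y p ->
  linspan (cell p) = [set x | forall i, rootR i y = 0 -> rootR i x = 0]%classic.
Proof.
move=> yp; apply/seteqP; split=> x /= Hx.
  move=> i iy.
  have lin : linear (rootR i : V -> R^o) by move=> a u w; rewrite rootR_linear.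
  pose f : V -> R^o := rootR i.
  pose fM := GRing.isLinear.Build _ _ _ _ f lin.
  pose fL : {linear V -> R^o} := HB.pack f fM.
  have fE v : (linfun fL v == 0) = (rootR i v == 0) by rewrite lfunE.
  have := Hx (lker (linfun fL)); rewrite memv_ker fE => H; apply/eqP; apply: H.
  move=> v vp; rewrite memv_ker fE.
  have /andP[i1 i2] : (i \in roots_of p) && (oppi i \in roots_of p).
    by rewrite (isface_eq0 i yp) iy.
  by rewrite eq_le (vp i i1) andbT -oppr_ge0 -rootR_oppi vp.
move=> U HU.
have [e e0 He] := small_perturbation (fun i => rootR i y) (fun i => rootR i x).
have yU : y \in U by apply: HU => i; rewrite (isface_ge0 i yp).
have : y + e *: x \in U.
  apply: HU => i; rewrite (isface_ge0 i yp) le_eqVlt => /predU1P[/esym i0|i0].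
    by rewrite rootRD rootRZ i0 Hx // mulr0 addr0.
  rewrite rootRD rootRZ; apply: ltW; apply: (He _ _ i).1 => //.
  by rewrite gtr0_norm.
by rewrite rpredDl // => /(memvZ e^-1); rewrite scalerA mulVf ?scale1r ?gt_eqF.
Qed.

Lemma relint_cellP p x : relint (cell p) x <-> isface x p.
Proof.
have [y yp] := par_face p; split=> [[xp Hx]|xp].
  have [|e e0 He] := Hx y; first by rewrite (linspan_cell yp).
  have {He} xe i : i \in roots_of p -> e * rootR i y <= rootR i x.
    have /(_ (- e)) := He; rewrite normrN gtr0_norm // => /(_ (lexx e) i) + ip => /(_ ip).
    by rewrite rootRD rootRZ; lra.
  apply/setP => i; rewrite inE.
  apply/idP/idP => [ip|ix]; first exact: xp.
  apply: contraT => ip; have : 0 < rootR (oppi i) y.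
    by rewrite -(isface_gt0 _ yp) oppiK.
  move=> niy; have := xe (oppi i); rewrite (isface_ge0 _ yp) (ltW niy) => /(_ isT).
  have := mulr_gt0 e0 niy; rewrite [rootR _ x]rootR_oppi; lra.
split=> [i|v]; first by rewrite (isface_ge0 _ xp).
rewrite (linspan_cell xp) => /= Hv.
have [e e0 He] := small_perturbation (fun i => rootR i x) (fun i => rootR i v).
exists e => // t te i.
rewrite (isface_ge0 _ xp) le_eqVlt rootRD rootRZ => /predU1P[/esym i0|i0].
  by rewrite i0 Hv // mulr0 addr0.
by apply: ltW; apply: (He _ te i).1.
Qed.

End Faces.

(** * Stabilizers in the Weyl group *)

Section WeylFix.
Variables (R : realType) (D : reductivePair R).
Local Notation I := (rootI D).
Local Notation V := (hR D).
Implicit Types (i j n : I) (x y v : V) (l : seq I).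

Lemma vec_reflK i : involutive (@vec_refl R D i).
Proof.
move=> x; rewrite /vec_refl rootRB rootRZ rootR_coroot -addrA -opprD -scalerDl.
have -> : rootR i x + (rootR i x - rootR i x * 2) = 0 by ring.
by rewrite scale0r subr0.
Qed.

Lemma qform_vec_refl_adj i x y : qform (vec_refl i x) y = qform x (vec_refl i y).
Proof. by rewrite -(qform_vec_refl i) vec_reflK. Qed.

(** Reflections conjugate reflections, as they preserve the form and hence map the
coroot of n to the coroot of the reflected root, modulo the radical. *)
Lemma root_refl_conj i n j :
  root_refl (root_refl i n) (root_refl i j) = root_refl i (root_refl n j).
Proof.
pose c := coroot_norm (root_refl i n) / coroot_norm n.
have H m : rootR m (coroot (root_refl i n)) = c * rootR m (vec_refl i (coroot n)).
  apply: (mulfI (negbT (gt_eqF (coroot_norm_gt0 m)))).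
  rewrite [RHS]mulrCA -!qform_coroot qform_vec_refl_adj qformC qform_coroot.
  rewrite [qform (coroot n) _]qformC qform_coroot rootR_vec_refl /c.
  by rewrite mulrA divfK // gt_eqF ?coroot_norm_gt0.
have c1 : c = 1.
  by have := H (root_refl i n); rewrite rootR_refl_refl !rootR_coroot; lra.
apply: rootR_inj => x; rewrite rootR_root_refl H c1 mul1r rootR_refl_refl.
by rewrite -!rootR_vec_refl [RHS]rootR_vec_refl rootR_root_refl.
Qed.

(** A product of reflections, as a word in the indices of the roots; [word_vec] is the
contragredient action, see [rootR_word]. *)
Definition word_root l j : I := foldr (@root_refl R D) j l.
Definition word_vec l v : V := foldr (@vec_refl R D) v l.

Lemma rootR_word l j v : rootR (word_root l j) (word_vec l v) = rootR j v.
Proof. by elim: l => //= i l IH; rewrite rootR_refl_refl. Qed.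

Lemma word_root_cat l l' j : word_root (l ++ l') j = word_root l (word_root l' j).
Proof. exact: foldr_cat. Qed.

Lemma word_rootK l : cancel (word_root l) (word_root (rev l)).
Proof.
by elim: l => // i l IH j; rewrite rev_cons -cats1 word_root_cat /= root_reflK IH.
Qed.

Lemma word_rootVK l : cancel (word_root (rev l)) (word_root l).
Proof. by move=> j; rewrite -{1}[l]revK word_rootK. Qed.

Lemma word_root_conj l n j :
  root_refl (word_root l n) (word_root l j) = word_root l (root_refl n j).
Proof. by elim: l => //= i l IH; rewrite root_refl_conj IH. Qed.

Lemma word_vec_eq l l' v : word_root l =1 word_root l' ->
  forall j, rootR j (word_vec l v) = rootR j (word_vec l' v).
Proof.
move=> e j; rewrite -(word_rootVK l j) rootR_word e.
by rewrite rootR_word.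
Qed.

Lemma weyl_word (w : {perm I}) : w \in weyl_group D -> exists l, w =1 word_root l.
Proof.
pose G := [set w : {perm I} | `[< exists l, w =1 word_root l >] ].
have gG : group_set G.
  apply/group_setP; split; first by rewrite inE; apply/asboolP; exists [::] => j; rewrite perm1.
  move=> u v; rewrite !inE => -[l ul] [l' vl].
  by exists (l' ++ l) => j; rewrite permM word_root_cat vl ul.
suff /fintype.subsetP H : weyl_group D \subset G by move=> /H; rewrite inE => /asboolP.
rewrite -[G]/(gval (group gG)) gen_subG; apply/fintype.subsetP => u.
rewrite inE => /existsP[i /forallP ui]; rewrite inE; apply/asboolP.
exists [:: i] => j /=; apply: rootR_inj => x; apply: complexI.
rewrite -rootRE (eqP (ui j)) add_lfunE opp_lfunE scale_lfunE rootR_root_refl.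
by rewrite !rootRE rmorphB rmorphM.
Qed.

Definition multiple_of i j := exists c, forall v, rootR j v = c * rootR i v.

Section Chamber.
Variable x0 : V.
Hypothesis x0_regular : forall i, rootR i x0 <> 0.

Definition positive i := 0 < rootR i x0.
Definition dominant v := forall i, positive i -> 0 <= rootR i v.
(** i spans a wall of the chamber of x0: the point h is generic in the intersection of
the closed chamber with the hyperplane of i. *)
Definition wall i := positive i /\
  exists2 h, rootR i h = 0 & forall j, positive j -> 0 < rootR j h \/ multiple_of i j.

Lemma positive_oppi i : positive (oppi i) = ~~ positive i.
Proof.
rewrite /positive rootR_oppi oppr_gt0 -leNgt le_eqVlt.
by have /eqP/negPf -> := @x0_regular i.
Qed.

(** A point h generic on the wall is fixed by the reflection, and at h the root j is
positive. *)
Lemma wall_root_refl i j : wall i -> positive j -> ~ multiple_of i j ->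
  positive (root_refl i j).
Proof.
move=> [ip [h h0 Hh]] jp nij; have [jh|//] := Hh j jp.
apply: contraT; rewrite -positive_oppi => /Hh.
have e : rootR (oppi (root_refl i j)) h = - rootR j h.
  by rewrite rootR_oppi rootR_root_refl h0 mulr0 subr0.
rewrite e => -[|[c Hc]]; first by lra.
by have := Hc h; rewrite e h0 mulr0; lra.
Qed.

Lemma positive_multiple i j c : positive i -> positive j ->
  (forall v, rootR j v = c * rootR i v) ->
  0 < c.
Proof. by move=> ip + jc; rewrite /positive jc pmulr_lgt0. Qed.

(** Choose x in the chamber so that the ray from x in direction v crosses the
hyperplanes of nonproportional roots at distinct times.  The first hyperplane that it
crosses is then a wall, and the crossing point h is generic on it. *)
Lemma separating_wall v : ~ dominant v -> exists2 i, wall i & rootR i v < 0.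
Proof.
move=> ndom; have [j0 j0p j0v] : exists2 j, positive j & rootR j v < 0.
  apply: contrapT => no; apply: ndom => j jp; rewrite leNgt; apply/negP => jv.
  by apply: no; exists j.
pose f (k : I * option I) (x : V) := if k.2 is Some j
  then rootR k.1 x * rootR j v - rootR j x * rootR k.1 v else rootR k.1 x.
have [|x Hx] := @generic_perturbation R _ V f _ x0.
  by move=> [i [j|]] a x y; rewrite /f /= !rootR_linear; ring.
have xp j : positive j -> 0 < rootR j x by have := (Hx (j, None)).1.
pose t j := rootR j x / - rootR j v.
pose A j := positive j && (rootR j v < 0).
have A0 : A j0 by rewrite /A j0p j0v.
(* t j is the time at which the ray from x in direction v crosses j. *)
have [i /andP[ip iv] ti] := Order.TotalTheory.arg_minP t A0.
exists i => //; split=> //.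
have niv : - rootR i v != 0 by rewrite oppr_eq0 lt_eqF.
have t0 : 0 < t i by rewrite divr_gt0 ?xp // oppr_gt0.
exists (t i *: v + x); first by rewrite rootR_linear /t; field; rewrite lt_eqF.
move=> j jp; rewrite rootR_linear.
have [jv|jv] := ltP (rootR j v) 0; last first.
  by left; rewrite ltr_wpDl ?xp // mulr_ge0 // ltW.
have tj : t i <= t j by apply: ti; rewrite /A jp jv.
have njv : - rootR j v != 0 by rewrite oppr_eq0 lt_eqF.
have -> : t i * rootR j v + rootR j x = (t j - t i) * - rootR j v.
  by rewrite /t; field; rewrite ?lt_eqF.
have [tij|tij] := eqVneq (t i) (t j); last first.
  by left; rewrite mulr_gt0 ?oppr_gt0 // subr_gt0 lt_neqAle tij.
right; have := (Hx (i, Some j)).2; rewrite /f /= => H.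
exists (rootR j v / rootR i v) => y.
have {}H : forall y, rootR i y * rootR j v - rootR j y * rootR i v = 0.
  apply: H; move: tij; rewrite /t => /eqP; rewrite eqr_div // => /eqP; lra.
have := H y => e; apply: (mulIf (negbT (lt_eqF iv))).
rewrite mulrAC divfK ?lt_eqF //; lra.
Qed.

(** Reflecting in a wall on whose wrong side v lies decreases the number of positive
roots that are negative at v: the positive roots not proportional to i are permuted,
and i leaves the set. *)
Lemma reach_dominant v : exists2 l, (forall i, i \in l -> wall i) & dominant (word_vec l v).
Proof.
pose N v := [set j | positive j && (rootR j v < 0)].
have [m] := ubnP #|N v|; elim: m v => // m IH v Hm.
have [dv|/separating_wall[i iw iv]] := pselect (dominant v); first by exists [::].
have [ip _] := iw.
have [|l lw ld] := IH (vec_refl i v).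
  apply: leq_trans (_ : #|N v| <= m)%N; last by rewrite -ltnS.
  rewrite (cardsD1 i (N v)) inE ip iv ltnS -(card_imset _ (can_inj (root_reflK i))).
  apply/subset_leq_card/fintype.subsetP => _ /imsetP[j jN ->].
  move: jN; rewrite !inE rootR_vec_refl => /andP[jp jv].
  rewrite jv andbT; have nij : ~ multiple_of i j.
    move=> [c jc]; have c0 := positive_multiple ip jp jc.
    move: jv; rewrite -rootR_vec_refl jc rootR_vec_refl rootR_oppi pmulr_rlt0 //; lra.
  rewrite wall_root_refl // andbT; apply/eqP => e.
  by move: jp; rewrite -(root_reflK i j) e -/(oppi i) positive_oppi ip.
exists (rcons l i); last by rewrite /word_vec foldr_rcons.
by move=> j; rewrite mem_rcons inE => /predU1P[->|/lw].
Qed.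

(** Move a generic point h of the hyperplane of n into the closed chamber by a word l
in the walls.  Only multiples of the image g of n vanish at the image of h, so g or
its opposite is a wall; then conjugate back. *)
Lemma root_refl_walls n : exists2 l, (forall i, i \in l -> wall i) & root_refl n =1 word_root l.
Proof.
(* f j is the root j composed with the projection to the hyperplane of n. *)
pose f j (x : V) := rootR j x - rootR n x * rootR j (coroot n) / 2.
have [|z Hz] := @generic_perturbation R _ V f _ x0.
  by move=> j a x y; rewrite /f !rootR_linear; ring.
pose h := z - (rootR n z / 2) *: coroot n.
have fh j : rootR j h = f j z by rewrite /h rootRB rootRZ /f; ring.
have nh : rootR n h = 0 by rewrite fh /f rootR_coroot; field.
have hm j : rootR j h = 0 -> multiple_of n j.
  rewrite fh => /((Hz j).2) fj; exists (rootR j (coroot n) / 2) => v.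
  by have := fj v; rewrite /f; lra.
have [l lw ld] := reach_dominant h.
pose g := word_root l n.
have gh : rootR g (word_vec l h) = 0 by rewrite rootR_word.
have hg j : rootR j (word_vec l h) = 0 -> multiple_of g j.
  rewrite -{1}(word_rootVK l j) rootR_word => /hm[c Hc]; exists c => v.
  have [v' e] : exists v', forall m, rootR (word_root l m) v = rootR m v'.
    exists (word_vec (rev l) v) => m.
    by rewrite -[in RHS](word_rootK l m) rootR_word.
  by rewrite -{1}(word_rootVK l j) !e.
have [a [c c0 ca] ap] : exists2 a, exists2 c, c != 0 & forall v, rootR a v = c * rootR g v
    & positive a.
  have [gp|gp] := boolP (positive g).
    by exists g => //; exists 1 => [|v]; rewrite ?oner_eq0 ?mul1r.
  exists (oppi g); last by rewrite positive_oppi.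
  by exists (-1) => [|v]; rewrite ?oppr_eq0 ?oner_eq0 // rootR_oppi mulN1r.
have aw : wall a.
  split=> //; exists (word_vec l h); first by rewrite ca gh mulr0.
  move=> j jp; have := ld j jp; rewrite le_eqVlt => /predU1P[/esym/hg[b Hb]|]; last by left.
  by right; exists (b / c) => v; rewrite Hb ca; field.
exists (rev l ++ a :: l).
  by move=> i; rewrite mem_cat inE mem_rev => /or3P[/lw|/eqP->|/lw].
move=> j; rewrite word_root_cat /= (root_refl_proportional ca) word_root_conj word_rootK.
by [].
Qed.

Lemma word_walls l : exists2 l', (forall i, i \in l' -> wall i) & word_root l =1 word_root l'.
Proof.
elim: l => [|n l [l' lw le]]; first by exists [::].
have [l2 l2w l2e] := root_refl_walls n; exists (l2 ++ l').
  by move=> i; rewrite mem_cat => /orP[/l2w|/lw].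
by move=> j; rewrite word_root_cat /= l2e le.
Qed.

(** Applying the letters of l one by one, some letter turns a positive root into a
negative one; [wall_root_refl] says which root that is. *)
Lemma word_crossing l n : (forall i, i \in l -> wall i) -> positive n ->
  ~~ positive (word_root l n) ->
  exists l1 i l2, l = l1 ++ i :: l2 /\ multiple_of i (word_root l2 n).
Proof.
elim: l => [|i l IH] lw np /= nn; first by rewrite np in nn.
have iw : wall i by apply: lw; rewrite inE eqxx.
have [p|p] := boolP (positive (word_root l n)).
  exists [::], i, l; split=> //; apply: contrapT => nm.
  by move/negP: nn; apply; apply: wall_root_refl.
have [|l1 [i' [l2 [-> Hm]]]] := IH _ np p; last by exists (i :: l1), i', l2.
by move=> m ml; apply: lw; rewrite inE ml orbT.
Qed.

(** The deletion argument, by induction on the length of the word.  If the last letter n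
moves v, its root is negative at the reflected vector, and so the rest of the word
must turn n into a negative root.  The letter i where this happens is then conjugate
to n, and both letters can be removed. *)
Lemma dominant_unique l v : (forall i, i \in l -> wall i) ->
  dominant v -> dominant (word_vec l v) -> forall j, rootR j (word_vec l v) = rootR j v.
Proof.
have [m] := ubnP (size l); elim: m l => // m IH l Hm lw dv.
case/lastP: l lw Hm => // l n lw; rewrite size_rcons ltnS => Hm.
have nw : wall n by apply: lw; rewrite mem_rcons inE eqxx.
have np := nw.1.
rewrite /word_vec foldr_rcons -/(word_vec _ _) => dlv.
have {}lw i : i \in l -> wall i by move=> il; apply: lw; rewrite mem_rcons inE il orbT.
have := dv n np; rewrite le_eqVlt => /predU1P[/esym nv|nv].
  have e : vec_refl n v = v by rewrite /vec_refl nv scale0r subr0.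
  by rewrite e in dlv *; apply: IH.
have [|l1 [i [l2 [lE [c Hc]]]]] := @word_crossing l n lw np.
  apply/negP => /dlv; rewrite rootR_word rootR_vec_refl rootR_oppi; lra.
have e : word_root (rcons l n) =1 word_root (l1 ++ l2).
  move=> j; rewrite -cats1 word_root_cat lE word_root_cat /= -(word_root_conj l2).
  by rewrite (root_refl_proportional Hc) root_reflK word_root_cat.
have ve := word_vec_eq v e; rewrite /word_vec foldr_rcons -!/(word_vec _ _) in ve.
move=> j; rewrite ve; apply: IH => //.
- by move: Hm; rewrite lE !size_cat /=; lia.
- move=> k; rewrite mem_cat => kl; apply: lw; rewrite lE mem_cat inE.
  by case/orP: kl => ->; rewrite ?orbT.
- by move=> k /dlv; rewrite ve.
Qed.

End Chamber.

(** Choose a chamber whose closure contains v.  The transform of v is again dominant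
as the signs of the roots agree, so [dominant_unique] applies. *)
Lemma weyl_fix (w : {perm I}) v : w \in weyl_group D ->
  (forall i, (0 <= rootR (w i) v) = (0 <= rootR i v)) ->
  forall i, rootR (w i) v = rootR i v.
Proof.
move=> wW Hw; have [l0 wl0] := weyl_word wW.
have [|x0 Hx0] := @generic_perturbation R _ V (@rootR R D) _ v.
  by move=> *; rewrite rootR_linear.
have x0r i : rootR i x0 <> 0.
  move=> i0; have := (Hx0 i).2 i0 (coroot i); rewrite rootR_coroot => /eqP.
  by rewrite pnatr_eq0.
have [l lw le] := word_walls x0r l0.
have dv : dominant x0 v.
  move=> i ip; rewrite leNgt -oppr_gt0 -rootR_oppi; apply/negP => /(Hx0 _).1.
  by apply/negP; rewrite -/(positive x0 _) positive_oppi // ip.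
have wl j : w j = word_root l j by rewrite wl0 le.
have dlv : dominant x0 (word_vec l v).
  move=> i /dv; rewrite -{1 2}(word_rootVK l i) rootR_word.
  by rewrite -wl Hw.
move=> j; rewrite -(rootR_word l j v) -wl; apply/esym.
exact: dominant_unique x0r _ _ lw dv dlv _.
Qed.

End WeylFix.

(** * The Tits product *)

Section TitsProduct.
Variables (R : realType) (D : reductivePair R).
Local Notation I := (rootI D).
Local Notation V := (hR D).
Local Notation root := (@Defs.root R D).
Implicit Types (i j : I) (a c x y v : V) (p q r s : par D).

Lemma root_oppi i : root (oppi i) = - root i.
Proof.
apply: cartan_form_ext => x.
by rewrite opp_lfunE !rootRE rootR_oppi rmorphN.
Qed.

Lemma levi_rootE a p i : isface a p -> (root_space i <= levi p)%VS = (rootR i a == 0).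
Proof.
move=> ap; have -> : levi p =
    subspace_of [set j in roots_of p | [exists l in roots_of p, root l == - root j]].
  by congr (_ + _)%VS; apply: eq_bigl => j; rewrite [RHS]inE.
rewrite root_space_subE inE -(isface_eq0 _ ap); congr (_ && _).
apply/existsP/idP => [[l /andP[lp]]|ip]; last by exists (oppi i); rewrite ip root_oppi /=.
by rewrite -root_oppi => /eqP/root_inj <-.
Qed.

Lemma levi_zeroE a c p q : isface a p -> isface c q ->
  levi_zero p q =
  [set x | forall i, rootR i a = 0 -> rootR i c = 0 -> rootR i x = 0]%classic.
Proof.
move=> ap cq; have H i : (i \in roots_of (levi p :&: levi q)%VS) =
    (rootR i a == 0) && (rootR i c == 0).
  by rewrite inE subv_cap (levi_rootE i ap) (levi_rootE i cq).
apply/seteqP; split=> x Hx i.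
  by move=> ia ic; apply: Hx; rewrite H ia ic eqxx.
by rewrite H => /andP[/eqP ia /eqP ic]; apply: Hx.
Qed.

(** The roots that are nonnegative right after the start of the segment from a to c. *)
Definition lex_roots a c : {set I} :=
  [set i | (0 < rootR i a) || ((rootR i a == 0) && (0 <= rootR i c))].

Lemma rootR_segment i a c t :
  rootR i (segment a c t) = rootR i a + t * (rootR i c - rootR i a).
Proof. by rewrite /segment rootRD !rootRZ; ring. Qed.

Lemma segment_start a c : exists2 e : R, 0 < e <= 1 / 2 &
  forall t, 0 < t <= e -> [set i | 0 <= rootR i (segment a c t)] = lex_roots a c.
Proof.
have [e e0 He] := small_perturbation (fun i => rootR i a) (fun i => rootR i c - rootR i a).
exists (Num.min e (1 / 2)).
  by rewrite lt_min e0 ge_min lexx orbT andbT divr_gt0 ?ltr0n.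
move=> t /andP[t0]; rewrite le_min => /andP[te _].
have {}He := He t _; rewrite gtr0_norm // in He; have {}He := He te.
apply/setP => i; rewrite !inE rootR_segment.
have [ia|ia|/esym ia] := ltgtP 0 (rootR i a).
- by rewrite ltW // (He i).1.
- by apply/negbTE; rewrite -ltNge (He i).2.
- by rewrite ia add0r subr0 pmulr_rge0.
Qed.

Lemma lex_roots_eq0 a c i : (i \in lex_roots a c) && (oppi i \in lex_roots a c) =
  (rootR i a == 0) && (rootR i c == 0).
Proof.
rewrite !inE !rootR_oppi oppr_gt0 oppr_ge0 oppr_eq0.
by case: (ltgtP (rootR i a) 0) => //= _; rewrite andbC -eq_le.
Qed.

Lemma lex_face_eq0 a c y i : [set j | 0 <= rootR j y] = lex_roots a c ->
  (rootR i y == 0) = (rootR i a == 0) && (rootR i c == 0).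
Proof.
by move=> e; rewrite -lex_roots_eq0 -e !inE rootR_oppi oppr_ge0 andbC -eq_le.
Qed.

Lemma lex_roots_indep p q a c a' c' : isface a p -> isface c q ->
  isface a' p -> isface c' q -> lex_roots a' c' = lex_roots a c.
Proof.
move=> ap cq a'p c'q; apply/setP => i; rewrite !inE.
by rewrite -(isface_gt0 i ap) -(isface_gt0 i a'p) -(isface_eq0 i ap) -(isface_eq0 i a'p)
  -(isface_ge0 i cq) -(isface_ge0 i c'q).
Qed.

(** The face reached right after a does not depend on the choice of a and c.  It spans
the space H where the roots of both Levi subalgebras vanish, because a root vanishes
on it exactly when it vanishes at both ends.  At time 0 the segment is still in the
face of a; if this face spans H too, then the roots that vanish at a
vanish at c, so the segment does not leave this face
at once. *)
Lemma first_chamber_lex p q r a c : isface a p -> isface c q ->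
  roots_of r = lex_roots a c -> first_chamber p q r.
Proof.
move=> ap cq rE; split.
  have [y yr] := par_face r; rewrite (linspan_cell yr) (levi_zeroE ap cq).
  have {}yr : [set j | 0 <= rootR j y] = lex_roots a c by rewrite -rE yr.
  apply/seteqP; split=> x Hx i.
    move=> ia ic; apply: Hx; apply/eqP; by rewrite (lex_face_eq0 _ yr) ia ic eqxx.
  by move=> /eqP; rewrite (lex_face_eq0 _ yr) => /andP[/eqP ia /eqP ic]; apply: Hx.
move=> a' c' /relint_cellP a'p /relint_cellP c'q.
have [e /andP[e0 e1] He] := segment_start a' c'.
have face t : 0 < t <= e -> isface (segment a' c' t) r.
  by move=> te; rewrite /isface rE He // (lex_roots_indep ap cq a'p c'q).
exists e; split.
- by rewrite ltW //=; lra.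
- by apply/relint_cellP/face; rewrite e0 lexx.
move=> t s /andP[t0 te] sspan /relint_cellP; move: t0; rewrite le_eqVlt => /predU1P[<-|t0] sf.
  have {}sf : isface a' s by move: sf; rewrite /segment subr0 scale1r scale0r addr0.
  suff a'r : isface a' r by apply: isface_unique sf a'r.
  move: sspan; rewrite (linspan_cell sf) (levi_zeroE a'p c'q) => sspan.
  have ac0 i : rootR i a' = 0 -> rootR i c' = 0.
    have : [set x : V | forall i, rootR i a' = 0 -> rootR i x = 0]%classic (segment a' c' e).
      rewrite sspan => j ja jc; rewrite rootR_segment ja jc; ring.
    move=> /(_ i) H ia; have := H ia; rewrite rootR_segment ia add0r subr0 => /eqP.
    by rewrite mulf_eq0 gt_eqF //= => /eqP.
  rewrite /isface rE -(lex_roots_indep ap cq a'p c'q); apply/setP => i; rewrite !inE.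
  rewrite [RHS]le_eqVlt orbC eq_sym; congr (_ || _).
  by have [/ac0 ->|_] := eqVneq (rootR i a') 0; rewrite ?lexx.
by apply: isface_unique sf (face t _); rewrite t0 te.
Qed.

(** Two candidates, tested on the same segment: the earlier of their two times is
admissible for the other candidate. *)
Lemma first_chamber_unique p q r r' :
  first_chamber p q r -> first_chamber p q r' -> r = r'.
Proof.
have [a ap] := par_face p; have [c cq] := par_face q.
move=> [rspan Hr] [r'span Hr'].
have /relint_cellP ar := ap; have /relint_cellP cr := cq.
have [t [/andP[t0 t1] tr Ht]] := Hr a c ar cr.
have [t' [/andP[t'0 t'1] tr' Ht']] := Hr' a c ar cr.
have [tt|/ltW tt] := leP t t'; first by apply: (Ht' t) => //; rewrite t0 tt.
by apply/esym; apply: (Ht t') => //; rewrite t'0 tt.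
Qed.

Lemma roots_of_tits p q a c : isface a p -> isface c q ->
  roots_of (tits p q) = lex_roots a c.
Proof.
move=> ap cq; have [e /andP[e0 e1] He] := segment_start a c.
have [r rf] := face_exists (segment a c e).
have rE : roots_of r = lex_roots a c by rewrite rf He ?e0 ?lexx.
suff -> : tits p q = r by [].
apply: xget_unique => [|s [sf _]].
  split; first exact: first_chamber_lex rE.
  apply: par_sub; rewrite rE ap; apply/fintype.subsetP => i; rewrite !inE.
  by case/orP=> [/ltW//|/andP[/eqP-> _]].
exact: first_chamber_unique sf (first_chamber_lex ap cq rE).
Qed.

Lemma segment_tits p q a c : isface a p -> isface c q ->
  exists2 e : R, 0 < e <= 1 / 2 &
  isface (segment a c e) (tits p q).
Proof.
move=> ap cq; have [e e01 He] := segment_start a c; exists e => //.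
by rewrite /isface (roots_of_tits ap cq) He // lexx; case/andP: e01 => ->.
Qed.

Lemma collinear_tits_l p q : collinear p (tits p q) q.
Proof.
have [a ap] := par_face p; have [c cq] := par_face q.
have [e /andP[e0 e1] He] := segment_tits ap cq.
exists a, (segment a c e), c, e; split; try exact/relint_cellP.
  by rewrite ltW //=; lra.
by [].
Qed.

(** The points of the two products are at distances e and f from the ends of the
segment, with e and f at most 1/2, so the former comes first. *)
Lemma collinear_tits_r p q : collinear (tits p q) (tits q p) q.
Proof.
have [a ap] := par_face p; have [c cq] := par_face q.
have [e /andP[e0 e1] He] := segment_tits ap cq.
have [f /andP[f0 f1] Hf] := segment_tits cq ap.
have e2 : 0 < 1 - e by lra.
exists (segment a c e), (segment c a f), c, (1 - f / (1 - e)).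
split; try exact/relint_cellP.
  rewrite subr_ge0 ler_pdivrMr // lerBlDr lerDl divr_ge0 ?(ltW f0) ?(ltW e2) // andbT.
  lra.
rewrite /segment scalerDr !scalerA -addrA -scalerDl addrC.
by congr (_ *: _ + _ *: _); field; rewrite gt_eqF.
Qed.

Lemma weyl_vector (w : weyl D) : exists phi : V -> V,
  forall j x, rootR (sgval w j) (phi x) = rootR j x.
Proof. by have [_ [f [_ fr]]] := weyl_realized (valP w); exists f. Qed.

Lemma weyl_surj (w : weyl D) i : exists j, i = sgval w j.
Proof. by exists ((sgval w)^-1%g i); rewrite permKV. Qed.

Lemma tits_wact (w : weyl D) p q : wact w (tits p q) = tits (wact w p) (wact w q).
Proof.
have [a ap] := par_face p; have [c cq] := par_face q.
have [f fE] := weyl_vector w.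
have H x r : isface x r -> isface (f x) (wact w r).
  move=> xr; apply/setP => i; have [j ->] := weyl_surj w i.
  by rewrite mem_roots_wact (isface_ge0 _ xr) inE fE.
apply: par_eq; apply/setP => i; have [j ->] := weyl_surj w i.
rewrite mem_roots_wact (roots_of_tits ap cq) (roots_of_tits (H _ _ ap) (H _ _ cq)).
by rewrite !inE !fE.
Qed.

(** Every point of the face of p is fixed by w, modulo the common kernel of the roots.
As y lies in the span of that face, x and x + e y are both such points for small e,
and hence y is fixed too. *)
Lemma wact_span_fix (w : weyl D) p q x y : isface x p -> isface y q ->
  (forall i, rootR i x = 0 -> rootR i y = 0) -> wact w p = p -> wact w q = q.
Proof.
move=> xp yq xy wp; have fix_ v : isface v p -> forall i, rootR (sgval w i) v = rootR i v.
  move=> vp; apply: weyl_fix => [|i]; first exact: valP.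
  by rewrite -!(isface_ge0 _ vp) -{1}wp mem_roots_wact.
have [e e0 He] := small_perturbation (fun i => rootR i x) (fun i => rootR i y).
have {}He := He e; rewrite gtr0_norm // lexx in He; have {}He := He isT.
have x'p : isface (x + e *: y) p.
  rewrite /isface xp; apply/setP => i; rewrite !inE rootRD rootRZ.
  have [ix|ix|/esym ix] := ltgtP 0 (rootR i x).
  - by rewrite ltW // (He i).1.
  - by apply/esym/negbTE; rewrite -ltNge (He i).2.
  - by rewrite ix xy // mulr0 addr0 lexx.
have wy i : rootR (sgval w i) y = rootR i y.
  have := fix_ _ x'p i; rewrite !rootRD !rootRZ (fix_ _ xp) => /addrI.
  by move/(mulfI (negbT (gt_eqF e0))).
apply: par_eq; apply/setP => i; have [j ->] := weyl_surj w i.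
by rewrite mem_roots_wact !(isface_ge0 _ yq) wy.
Qed.

(** The two products have the same span: the same roots vanish on both. *)
Lemma wact_tits_swap (w : weyl D) p q :
  wact w (tits p q) = tits p q -> wact w (tits q p) = tits q p.
Proof.
have [a ap] := par_face p; have [c cq] := par_face q.
have [x xr] := par_face (tits p q); have [y ys] := par_face (tits q p).
apply: (wact_span_fix xr ys) => i /eqP; rewrite -(isface_eq0 _ xr).
rewrite (roots_of_tits ap cq) lex_roots_eq0 andbC -lex_roots_eq0.
by rewrite -(roots_of_tits cq ap) (isface_eq0 _ ys) => /eqP.
Qed.

Lemma wact_tits_sub (w : weyl D) p q : wact w (tits p q) = tits p q -> wact w p = p.
Proof.
have [a ap] := par_face p; have [c cq] := par_face q.
have [x xr] := par_face (tits p q).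
apply: (wact_span_fix xr ap) => i /eqP; rewrite -(isface_eq0 _ xr).
by rewrite (roots_of_tits ap cq) lex_roots_eq0 => /andP[/eqP].
Qed.

End TitsProduct.

(** * Averages of transition morphisms *)

Section Averages.
Variables (k : fieldType) (R : realType) (D : reductivePair R).
Implicit Types (p q r s : par D) (w : weyl D).

Lemma Ind_tau p q (H : (p <= q)%VS) : Ind k H = tau k p q.
Proof.
apply/clP/(teq_trans _ (TTau_indep k H (subvv q)))/teq_sym.
exact: teq_trans (teq_comp (teq_res_id _ _) (teq_refl _)) (teq_idl _).
Qed.

Lemma Res_tau p q (H : (p <= q)%VS) : Res k H = tau k q p.
Proof.
apply/clP/(teq_trans _ (TTau_indep k (subvv q) H))/teq_sym.
exact: teq_trans (teq_comp (teq_refl _) (teq_ind_id _ _)) (teq_idr _).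
Qed.

Lemma actQ_tau w p q : actQ w (tau k p q) = tau k (wact w p) (wact w q).
Proof. by rewrite /tau actQE; apply/clP/tact_tau. Qed.

Lemma tau_collinear p q r : collinear p q r ->
  tau k p r = compQ (tau k q r) (tau k p q).
Proof. by move=> H; rewrite /tau compQE; apply/clP/teq_tau. Qed.

Lemma tau_tits p q : tau k p q =
  compQ (tau k (tits q p) q) (compQ (tau k (tits p q) (tits q p)) (tau k p (tits p q))).
Proof.
rewrite (tau_collinear (collinear_tits_l p q)) (tau_collinear (collinear_tits_r p q)).
by rewrite /tau !compQE; apply/clP/teq_sym/teq_compA.
Qed.

Definition pair_orbit p q p' q' :=
  [exists w : weyl D, (wact w p == p') && (wact w q == q')].

Lemma pair_orbitP p q p' q' :
  reflect (exists w, wact w p = p' /\ wact w q = q') (pair_orbit p q p' q').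
Proof.
apply: (iffP existsP) => [[w /andP[/eqP <- /eqP <-]]|[w [<- <-]]]; first by exists w.
by exists w; rewrite !eqxx.
Qed.

Lemma single_tau p q p' q' :
  single (tau k p q) p' q' = if (p == p') && (q == q') then tau k p' q' else 0.
Proof.
rewrite /single; case: pselect => [e|/eqP/negPf-> //].
case: pselect => [f|/eqP/negPf-> ]; last by rewrite andbF.
by subst p' q'; rewrite !eqxx.
Qed.

(** The elements of W that map (p, q) to (p', q') form a coset of the stabilizer of the
pair, and they contribute equal terms; the normalization divides by their number. *)
Lemma avg_tau (k_char0 : [pchar k] =i pred0) p q p' q' :
  avg (tau k p q) p' q' = if pair_orbit p q p' q' then tau k p' q' else 0.
Proof.
rewrite /= /avg_fam; under eq_bigr do rewrite actQ_tau single_tau.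
rewrite -big_mkcond /=; case: pair_orbitP => [[w0 [<- <-]]|no]; last first.
  rewrite big_pred0 ?scaler0 // => w; apply/negP => /andP[/eqP wp /eqP wq].
  by apply: no; exists w.
rewrite (reindex_inj (mulIg w0)) /=.
under eq_bigl do rewrite -!wactM !(inj_eq (@wact_inj _ _ w0)).
rewrite sumr_const -scaler_nat scalerA.
have -> : #|[pred w | (wact w p == p) && (wact w q == q)]| = #|wstab p :&: wstab q|.
  by apply: eq_card => w; rewrite !inE.
rewrite mulVf ?scale1r // (pcharf0P k).1 // -lt0n; apply/card_gt0P; exists 1%g.
by rewrite !inE !wact1 !eqxx.
Qed.

(** The elements u, v, w of W that realize the three orbit conditions may differ, but
v acts like u on q0 o p0, since they agree on p0 o q0, and w acts like u on q0,
since they agree on q0 o p0. *)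
Lemma pair_orbit_tits p0 q0 p r s q :
  pair_orbit p0 (tits p0 q0) p r -> pair_orbit (tits p0 q0) (tits q0 p0) r s ->
  pair_orbit (tits q0 p0) q0 s q ->
  [/\ pair_orbit p0 q0 p q, r = tits p q & s = tits q p].
Proof.
have stabM u v t t' : wact u t = t' -> wact v t = t' -> wact (v * u^-1)%g t = t.
  by move=> e1 e2; rewrite -wactM e2 -e1 wactM mulgV wact1.
have backM u v t t' : wact u t = t' -> wact (v * u^-1)%g t = t -> wact v t = t'.
  by move=> <- {2}<-; rewrite wactM mulgKV.
move=> /pair_orbitP[u [up ur]] /pair_orbitP[v [vr vs]] /pair_orbitP[w [ws wq]].
have us : wact u (tits q0 p0) = s.
  by apply: backM vs _; apply: wact_tits_swap; apply: stabM vr ur.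
have uq : wact u q0 = q.
  by apply: backM wq _; apply: (@wact_tits_sub _ _ _ _ p0); apply: stabM ws us.
split; first by apply/pair_orbitP; exists u.
  by rewrite -ur tits_wact up uq.
by rewrite -us tits_wact up uq.
Qed.

Lemma pair_orbit_tits_factors p0 q0 p q : pair_orbit p0 q0 p q ->
  [/\ pair_orbit p0 (tits p0 q0) p (tits p q),
      pair_orbit (tits p0 q0) (tits q0 p0) (tits p q) (tits q p) &
      pair_orbit (tits q0 p0) q0 (tits q p) q].
Proof.
case/pair_orbitP=> u [<- <-]; rewrite -!tits_wact.
by split; apply/pair_orbitP; exists u.
Qed.

Lemma pair_orbit_r p0 q0 p q : pair_orbit p0 q0 p q -> q \in worbit q0.
Proof. by case/pair_orbitP=> u [_ <-]; apply: imset_f. Qed.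

Lemma pair_orbit_l p0 q0 p q : pair_orbit p0 q0 p q -> p \in worbit p0.
Proof. by case/pair_orbitP=> u [<- _]; apply: imset_f. Qed.

Lemma compCE (O1 O2 O3 : objC D) (b : HomC k O2 O3) (a : HomC k O1 O2) p r :
  compC b a p r = \sum_(q in (O2 : {set par D})) compQ (b q r) (a p q).
Proof. by []. Qed.

(** The only chain p, r, s, q with a nonzero contribution is r = p o q, s = q o p. *)
Lemma comp_avg_tits (k_char0 : [pchar k] =i pred0) p0 q0 p q :
  compC (avg (Ind k (tits_sub q0 p0)))
    (compC (avg (tau k (tits p0 q0) (tits q0 p0))) (avg (Res k (tits_sub p0 q0)))) p q =
  if pair_orbit p0 q0 p q then tau k p q else 0.
Proof.
have avgE := avg_tau k_char0; rewrite Ind_tau Res_tau !compCE.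
case: ifP => [pq|npq].
  have [pr rs sq] := pair_orbit_tits_factors pq.
  rewrite (big_only1 (tits q p)); first last.
  - move=> s /eqP ns _; rewrite !avgE; case: ifP => [sq'|]; last by rewrite comp0Q.
    rewrite compCE big1 ?compQ0 // => r _.
    rewrite !avgE; case: ifP => [rs'|]; last by rewrite comp0Q.
    case: ifP => [pr'|]; last by rewrite compQ0.
    by have [_ _ e] := pair_orbit_tits pr' rs' sq'; case: ns.
  - exact: pair_orbit_r rs.
  rewrite compCE (big_only1 (tits p q)); first last.
  - move=> r /eqP nr _; rewrite !avgE; case: ifP => [rs'|]; last by rewrite comp0Q.
    case: ifP => [pr'|]; last by rewrite compQ0.
    by have [_ e _] := pair_orbit_tits pr' rs' sq; case: nr.
  - exact: pair_orbit_r pr.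
  by rewrite !avgE pr rs sq -tau_tits.
apply: big1 => s _; rewrite !avgE; case: ifP => [sq'|]; last by rewrite comp0Q.
rewrite compCE big1 ?compQ0 // => r _.
rewrite !avgE; case: ifP => [rs'|]; last by rewrite comp0Q.
case: ifP => [pr'|]; last by rewrite compQ0.
by have [] := pair_orbit_tits pr' rs' sq'; rewrite npq.
Qed.

Lemma wact_top w : wact w (par_top D) = par_top D.
Proof.
apply: par_eq; apply/setP => i; have [j ->] := weyl_surj w i.
by rewrite mem_roots_wact !inE !subvf.
Qed.

Lemma comp_avg_top (k_char0 : [pchar k] =i pred0) p0 q0 p q :
  compC (avg (Res k (par_topP q0))) (avg (Ind k (par_topP p0))) p q =
  if (p \in worbit p0) && (q \in worbit q0) then tau k p q else 0.
Proof.
have avgE := avg_tau k_char0; rewrite Ind_tau Res_tau !compCE.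
have -> : orb (par_top D) = [set par_top D] :> {set par D}.
  apply/setP => r; rewrite inE; apply/imsetP/eqP => [[w _ ->]|->].
    exact: wact_top.
  by exists 1%g; rewrite ?wact_top.
rewrite big_set1 !avgE.
have -> : pair_orbit p0 (par_top D) p (par_top D) = (p \in worbit p0).
  apply/pair_orbitP/imsetP => [[w [<- _]]|[w _ ->]]; first by exists w.
  by exists w; rewrite wact_top.
have -> : pair_orbit (par_top D) q0 (par_top D) q = (q \in worbit q0).
  apply/pair_orbitP/imsetP => [[w [_ <-]]|[w _ ->]]; first by exists w.
  by exists w; rewrite wact_top.
case: (p \in _); case: (q \in _); rewrite /= ?comp0Q ?compQ0 //.
by rewrite -(Res_tau (par_topP q)) -(Ind_tau (par_topP p)) /tau compQE.
Qed.

(** With p = u p0 and q = v q0, the pair lies in the orbit of (p0, w q0) exactly when w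
represents the double coset of the map u^-1 v. *)
Lemma pair_orbit_reps p0 q0 p q (S : {set weyl D}) : double_coset_reps p0 q0 S ->
  p \in worbit p0 -> q \in worbit q0 ->
  exists2 w, w \in S /\ pair_orbit p0 (wact w q0) p q &
    forall w', w' \in S -> pair_orbit p0 (wact w' q0) p q -> w' = w.
Proof.
move=> reps /imsetP[u _ ->] /imsetP[v _ ->].
have [w [[wS [a [b [aS bS vE]]]] wU]] := reps (v * u^-1)%g.
move: aS bS; rewrite !inE => /eqP ap /eqP bq.
exists w.
  split=> //; apply/pair_orbitP; exists (a * u)%g.
  rewrite -[in LHS]wactM ap; split=> //.
  by rewrite -{1}bq !wactM !mulgA -vE mulgKV.
move=> w' w'S /pair_orbitP[y [yp yq]]; apply/esym/wU; split=> //.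
exists (y * u^-1)%g, (v * y^-1 * w'^-1)%g; split.
- by rewrite inE -wactM yp wactM mulgV wact1.
- by rewrite inE -!wactM -yq wactM !wactM !mulgA mulgK mulgV wact1.
- by rewrite !mulgA mulgKV mulgKV.
Qed.

End Averages.

Theorem proposition4p6p1 (k : fieldType) (k_char0 : [pchar k] =i pred0)
    (R : realType) (D : reductivePair R) (p1 p2 : par D)
    (S : {set weyl D}) (S_reps : double_coset_reps p1 p2 S) :
  compC (avg (Res k (par_topP p2))) (avg (Ind k (par_topP p1))) =
  \sum_(w in S)
    castC (orb_wact w p2)
      (compC (avg (Ind k (tits_sub (wact w p2) p1)))
        (compC (avg (tau k (tits p1 (wact w p2)) (tits (wact w p2) p1)))
               (avg (Res k (tits_sub p1 (wact w p2))))))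
  :> HomC k (orb p1) (orb p2).
Proof.
apply: HomC_eq => p q; rewrite comp_avg_top //.
set F := BIG_F; have -> : (\sum_(w in S) F w) p q = \sum_(w in S) F w p q.
  by elim/big_rec2: _ => // w x y _ <-.
have FE w : F w p q = if pair_orbit p1 (wact w p2) p q then tau k p q else 0.
  by rewrite castCE comp_avg_tits.
under eq_bigr do rewrite FE.
case: ifP => [/andP[p1p p2q]|npq].
  have [w [wS wpq] wU] := pair_orbit_reps S_reps p1p p2q.
  rewrite (bigD1 w) //= wpq big1 ?addr0 // => w' /andP[w'S /eqP nw].
  by case: ifP => // /(wU w' w'S)/nw.
apply/esym/big1 => w _; case: ifP => // pq; move: npq.
by rewrite (pair_orbit_l pq) -(worbit_wact w) (pair_orbit_r pq).
Qed.
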